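(* Let $k$ be a field, let $q_2\ge 4$ be an even integer, and put $q_1=q_2+1$, $d_1=q_2-1$, and $$n_1=q_1q_2,\quad n_2=q_1d_1,\quad n_3=q_1q_2+d_1,\quad n_4=q_2d_1 .$$ Let $R=k[x_1,x_2,x_3,x_4]$ and let $\mathfrak p=\mathfrak p(\underline{\mathbf n})$ be the kernel of the $k$-algebra homomorphism $R\to k[t]$, $x_i\mapsto t^{n_i}$ ($1\le i\le 4$). Define $$f_\mu=x_1^{\mu-1}x_3^{q_2-\mu}-x_2^{q_2-\mu}x_4^{\mu+1}\ (1\le\mu\le q_2),\qquad g_1=x_1^{d_1}-x_2^{q_2},\qquad g_2=x_3x_4-x_2x_1,$$ $$h_m=x_1^m x_4^{q_1-m}-x_2^{q_2-m}x_3^m\ (1\le m\le q_2-2),$$ and let $S=\{f_\mu: 1\le\mu\le q_2\}\cup\{g_1,g_2\}\cup\{h_m: 1\le m\le q_2-2\}$. Then: (i) $S$ is a minimal generating set for the ideal $\mathfrak p$; (ii) $S$ is a Gröbner basis for $\mathfrak p$ with respect to the lexicographic monomial order induced by $x_3>x_2>x_1>x_4$ on $R$; (iii) $\beta_1(\mathfrak p)=|S|=2q_2$; (iv) $\beta_2(\mathfrak p)=4(q_2-1)$; (v) $\beta_3(\mathfrak p)=2q_2-3$; (vi) a minimal free resolution of $R/\mathfrak p$ over $R$ is $$0\longrightarrow R^{2q_2-3}\xrightarrow{\ P\ }R^{4(q_2-1)}\xrightarrow{\ N\ }R^{2q_2}\longrightarrow R\longrightarrow R/\mathfrak p\longrightarrow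 0,$$ where the map $R^{2q_2}\to R$ is given by the row $(f_1,\ldots,f_{q_2},g_1,g_2,h_1,\ldots,h_{q_2-2})$, and $N$ (of size $2q_2\times 4(q_2-1)$) and $P$ (of size $4(q_2-1)\times(2q_2-3)$) are the matrices with columns, in this order, $$N=[\boldsymbol\beta_1\ldots\boldsymbol\beta_{q_2-1}\mid\boldsymbol\gamma'_1\ldots\boldsymbol\gamma'_{q_2-3}\mid\boldsymbol\alpha'\mid\boldsymbol\beta'_2\ldots\boldsymbol\beta'_{q_2-2}\mid\boldsymbol\alpha_1\ldots\boldsymbol\alpha_{q_2-1}\mid-\boldsymbol\gamma\mid\boldsymbol\beta'\mid\boldsymbol\gamma'],$$ $$P=[\boldsymbol\delta_1\ldots\boldsymbol\delta_{q_2-2}\mid\boldsymbol\xi\mid\boldsymbol\zeta\mid\boldsymbol\eta\mid\boldsymbol\kappa_1\ldots\boldsymbol\kappa_{q_2-4}],$$ the column vectors being those defined in the context.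
   Context: **Betti numbers.** Here $\beta_i(\mathfrak p)$ is indexed so that $\beta_1(\mathfrak p)$ is the minimal number of generators of $\mathfrak p$; i.e. $\beta_i(\mathfrak p)=\dim_k\operatorname{Tor}_i^R(R/\mathfrak p,k)$, where $k=R/\mathfrak m$ and $\mathfrak m=\langle x_1,x_2,x_3,x_4\rangle$, which is the rank of the $i$-th free module in the minimal free resolution of $R/\mathfrak p$ over $R$ (graded by $\deg x_i=n_i$). Minimality of the resolution means that all entries of the maps between the free modules lie in $\mathfrak m$. **Columns of $N$.** These are vectors in $R^{2q_2}$; the coordinates $1,\ldots,2q_2$ correspond in order to $f_1,\ldots,f_{q_2},g_1,g_2,h_1,\ldots,h_{q_2-2}$ (so $f_\mu$ is at position $\mu$, $g_1$ at $q_2+1$, $g_2$ at $q_2+2$, $h_m$ at $q_2+2+m$). All coordinates not listed are $0$. - $\boldsymbol\beta_\mu$ ($1\le\mu\le q_2-1$): coordinate $\mu$ is $-x_1$; coordinate $\mu+1$ is $x_3$; coordinate $q_2+2$ is $x_2^{q_2-(\mu+1)}x_4^{\mu+1}$. - $\boldsymbol\alpha_\mu$ ($1\le\mu\le q_2-1$): coordinate $\mu$ is $-x_4$; coordinate $\mu+1$ is $x_2$; coordinate $q_2+2$ is $x_1^{\mu-1}x_3^{q_2-(\mu+1)}$. - $\boldsymbol\gamma$: coordinate $q_2-1$ is $-x_1$; coordinate $q_2+1$ is $x_3$; coordinate $q_2+3$ is $-x_2$. - $\boldsymbol\alpha'$: coordinate $q_2$ is $-x_1$; coordinate $q_2+1$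 is $x_1$; coordinate $q_2+2$ is $-x_2^{q_2-1}$; coordinate $q_2+3$ is $-x_4$. - $\boldsymbol\beta'_m$ ($2\le m\le q_2-2$): coordinate $q_2+2$ is $x_2^{q_2-m}x_3^{m-1}$; coordinate $q_2+m+1$ is $-x_1$; coordinate $q_2+m+2$ is $x_4$. - $\boldsymbol\gamma'_m$ ($1\le m\le q_2-3$): coordinate $q_2+2$ is $-x_1^mx_4^{q_2-m}$; coordinate $q_2+m+2$ is $x_3$; coordinate $q_2+m+3$ is $-x_2$. - $\boldsymbol\beta'$: coordinate $1$ is $-x_2^2$; coordinate $q_2+1$ is $x_2x_4^2$; coordinate $q_2+2$ is $x_1^{q_2-2}x_4^2$; coordinate $2q_2$ is $-x_3$. - $\boldsymbol\gamma'$: coordinate $2$ is $-x_2^2$; coordinate $q_2+1$ is $x_4^3$; coordinate $2q_2$ is $-x_1$. **Columns of $P$.** These are vectors in $R^{4(q_2-1)}$. All coordinates not listed are $0$. - $\boldsymbol\delta_\mu$ ($1\le\mu\le q_2-2$): coordinate $\mu$ is $x_4$; coordinate $\mu+1$ is $-x_2$; coordinate $3q_2-6+\mu$ is $-x_1$; coordinate $3q_2-5+\mu$ is $x_3$. - $\boldsymbol\xi$: coordinate $1$ is $x_2^2$; coordinate $2q_2-3$ is $x_2x_4^2$; coordinate $4q_2-7$ is $x_1x_4^2$; coordinate $4q_2-6$ is $x_4^3$; coordinate $4q_2-5$ is $-x_1$; coordinate $4q_2-4$ is $x_3$. - $\boldsymbol\zeta$: coordinate $q_2-1$ is $x_1$;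 coordinate $q_2$ is $x_4$; coordinate $2q_2-3$ is $x_3$; coordinate $2q_2-2$ is $x_2$; coordinate $4q_2-6$ is $x_1$. - $\boldsymbol\eta$: coordinate $2q_2-4$ is $-x_1$; coordinate $3q_2-6$ is $-x_3$; coordinate $3q_2-5$ is $x_2^2$; coordinate $4q_2-5$ is $-x_4$; coordinate $4q_2-4$ is $x_2$. - $\boldsymbol\kappa_\mu$ ($1\le\mu\le q_2-4$; none if $q_2=4$): coordinate $q_2-1+\mu$ is $-x_1$; coordinate $q_2+\mu$ is $x_4$; coordinate $2q_2-3+\mu$ is $-x_3$; coordinate $2q_2-2+\mu$ is $x_2$. *)

(* Defs.v *)
From HB Require Import structures.
From mathcomp Require Import all_boot all_order all_algebra.
From mathcomp Require Import zify.
From mathcomp Require Export mpoly.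

Set Implicit Arguments.
Unset Strict Implicit.
Unset Printing Implicit Defensive.

Import Order.TTheory GRing.Theory.
Local Open Scope ring_scope.

(* Ideals are represented as predicates [{mpoly k[n]} -> Prop]. *)
Section Ideals.
Variables (k : fieldType) (n : nat).
Local Notation R := {mpoly k[n]}.
Implicit Types (A I : R -> Prop) (S T : seq R).

Definition ideal_gen A : R -> Prop := fun f =>
  exists (m : nat) (a b : 'I_m -> R),
    (forall i, A (b i)) /\ f = \sum_(i < m) a i * b i.

Definition of_seq S : R -> Prop := fun f => f \in S.

Definition generates S I : Prop := forall f, ideal_gen (of_seq S) f <-> I f.

Definition minimal_generating_set S I : Prop :=
  generates S I /\
  forall T, {subset T <= S} -> generates T I -> {subset S <= T}.

Definition max_ideal : R -> Prop :=
  ideal_gen (fun f => exists i : 'I_n, f = 'X_i).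

End Ideals.

Section Groebner.
Variables (k : fieldType) (n : nat).
Local Notation R := {mpoly k[n]}.

(* [vs] lists the variables from the largest to the smallest. *)
Definition lex_key (vs : seq 'I_n) (m : 'X_{1..n}) : seqlexi nat :=
  [seq m i | i <- vs].

Definition lex_le (vs : seq 'I_n) (m1 m2 : 'X_{1..n}) : bool :=
  (lex_key vs m1 <= lex_key vs m2)%O.

Variable le : rel 'X_{1..n}.

(* The zero polynomial has no leading monomial. *)
Definition is_lead_monomial (f : R) (m : 'X_{1..n}) : Prop :=
  m \in msupp f /\ forall m', m' \in msupp f -> le m' m.

Definition lead_terms (A : R -> Prop) : R -> Prop := fun t =>
  exists f m, [/\ A f, is_lead_monomial f m & t = f@_m *: 'X_[m]].

Definition groebner_basis (S : seq R) (I : R -> Prop) : Prop :=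
  (forall f, f \in S -> I f) /\
  forall t, ideal_gen (lead_terms (of_seq S)) t <-> ideal_gen (lead_terms I) t.

End Groebner.

Section Resolutions.
Variables (k : fieldType) (n : nat).
Local Notation R := {mpoly k[n]}.

(* Finitely generated free modules F_i = R^(rk i) of column vectors, with
   F_(i+1) -> F_i given by [dif i]. The row [aug] represents a map from F_0 to
   a cyclic module R/I, namely v |-> class of [aug *m v]. *)
Record free_complex := FreeComplex {
  rk : nat -> nat;
  aug : 'rV[R]_(rk 0%N);
  dif : forall i, 'M[R]_(rk i, rk i.+1)
}.

Implicit Types (F : free_complex) (I : R -> Prop).

Definition free_resolution I F : Prop :=
  [/\ forall f : R, exists v : 'cV[R]_(rk F 0), I (f - (aug F *m v) 0 0),
      forall v : 'cV[R]_(rk F 0),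
        I ((aug F *m v) 0 0) <-> exists w, v = dif F 0 *m w
    & forall i (v : 'cV[R]_(rk F i.+1)),
        dif F i *m v = 0 <-> exists w, v = dif F i.+1 *m w].

Definition minimal F : Prop :=
  forall i a b, max_ideal (dif F i a b).

Definition weight (w : 'I_n -> nat) (m : 'X_{1..n}) : nat :=
  (\sum_(i < n) m i * w i)%N.

(* [s i a] is the degree of the a-th basis vector of F_i, so that all the maps
   are homogeneous of degree 0 when x_i has degree [w i]. *)
Definition graded (w : 'I_n -> nat) F : Prop :=
  exists s : forall i, 'I_(rk F i) -> nat,
    (forall a m, m \in msupp (aug F 0 a) -> weight w m = s 0%N a) /\
    forall i a b m, m \in msupp (dif F i a b) ->
      s i.+1 b = (s i a + weight w m)%N.

Definition minimal_free_resolution (w : 'I_n -> nat) I F : Prop :=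
  [/\ free_resolution I F, minimal F & graded w F].

(* [dif F i] tensored with the residue field R/m, which is identified with k by
   evaluation at the origin. *)
Definition dif_residue F i : 'M[k]_(rk F i, rk F i.+1) :=
  map_mx (meval (fun _ => 0)) (dif F i).

(* Dimension of the i-th homology of F (x) R/m; the columns of [cokermx A]
   span the kernel of v |-> A *m v. *)
Definition homology_dim F i : nat :=
  match i with
  | 0 => rk F 0 - \rank (dif_residue F 0)
  | j.+1 => \rank (cokermx (dif_residue F j)) - \rank (dif_residue F j.+1)
  end.

(* dim_k Tor_i(R/I, R/m) = b, whichever resolution of R/I is used. *)
Definition betti I i (b : nat) : Prop :=
  (exists F, free_resolution I F) /\
  forall F, free_resolution I F -> homology_dim F i = b.

End Resolutions.

Section Family.
Variables (k : fieldType) (q2 : nat).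
Local Notation R := {mpoly k[4]}.

Definition q1 : nat := q2 + 1.
Definition d1 : nat := q2 - 1.

Definition degs : 'I_4 -> nat :=
  fun i => nth 0%N [:: q1 * q2; q1 * d1; q1 * q2 + d1; q2 * d1]%N i.

Definition i1 : 'I_4 := @Ordinal 4 0 isT.
Definition i2 : 'I_4 := @Ordinal 4 1 isT.
Definition i3 : 'I_4 := @Ordinal 4 2 isT.
Definition i4 : 'I_4 := @Ordinal 4 3 isT.

Definition x1 : R := 'X_i1.
Definition x2 : R := 'X_i2.
Definition x3 : R := 'X_i3.
Definition x4 : R := 'X_i4.

Definition toric_map : R -> {poly k} := mmap polyC (fun i => 'X^(degs i)).

Definition toric_ideal : R -> Prop := fun f => toric_map f = 0.

Definition f_ (mu : nat) : R :=
  x1 ^+ (mu - 1) * x3 ^+ (q2 - mu) - x2 ^+ (q2 - mu) * x4 ^+ (mu + 1).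
Definition g1 : R := x1 ^+ d1 - x2 ^+ q2.
Definition g2 : R := x3 * x4 - x2 * x1.
Definition h_ (m : nat) : R :=
  x1 ^+ m * x4 ^+ (q1 - m) - x2 ^+ (q2 - m) * x3 ^+ m.

Definition gens : seq R :=
  [seq f_ mu | mu <- iota 1 q2] ++ [:: g1; g2] ++
  [seq h_ m | m <- iota 1 (q2 - 2)].

Definition lex3214 : rel 'X_{1..4} := lex_le [:: i3; i2; i1; i4].

(* A sparse vector is a list of pairs (coordinate, value), with coordinates
   counted from 1 and pairwise distinct; unlisted coordinates are 0. *)
Definition svec := seq (nat * R).

Definition coord (c : svec) (i : nat) : R :=
  \sum_(p <- c | p.1 == i) p.2.

Definition sopp (c : svec) : svec := [seq (p.1, - p.2) | p <- c].

Definition matrix_of_cols (a b : nat) (cs : seq svec) : 'M[R]_(a, b) :=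
  \matrix_(i, j) coord (nth [::] cs j) i.+1.

Definition beta (mu : nat) : svec :=
  [:: (mu, - x1); ((mu + 1)%N, x3);
      ((q2 + 2)%N, x2 ^+ (q2 - (mu + 1)) * x4 ^+ (mu + 1))].
Definition alpha (mu : nat) : svec :=
  [:: (mu, - x4); ((mu + 1)%N, x2);
      ((q2 + 2)%N, x1 ^+ (mu - 1) * x3 ^+ (q2 - (mu + 1)))].
Definition gamma : svec :=
  [:: ((q2 - 1)%N, - x1); ((q2 + 1)%N, x3); ((q2 + 3)%N, - x2)].
Definition alpha' : svec :=
  [:: (q2, - x1); ((q2 + 1)%N, x1); ((q2 + 2)%N, - x2 ^+ (q2 - 1));
      ((q2 + 3)%N, - x4)].
Definition beta'_ (m : nat) : svec :=
  [:: ((q2 + 2)%N, x2 ^+ (q2 - m) * x3 ^+ (m - 1)); ((q2 + m + 1)%N, - x1);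
      ((q2 + m + 2)%N, x4)].
Definition gamma'_ (m : nat) : svec :=
  [:: ((q2 + 2)%N, - (x1 ^+ m * x4 ^+ (q2 - m))); ((q2 + m + 2)%N, x3);
      ((q2 + m + 3)%N, - x2)].
Definition beta' : svec :=
  [:: (1%N, - x2 ^+ 2); ((q2 + 1)%N, x2 * x4 ^+ 2);
      ((q2 + 2)%N, x1 ^+ (q2 - 2) * x4 ^+ 2); ((2 * q2)%N, - x3)].
Definition gamma' : svec :=
  [:: (2%N, - x2 ^+ 2); ((q2 + 1)%N, x4 ^+ 3); ((2 * q2)%N, - x1)].

Definition Ncols : seq svec :=
  [seq beta mu | mu <- iota 1 (q2 - 1)] ++
  [seq gamma'_ m | m <- iota 1 (q2 - 3)] ++
  [:: alpha'] ++
  [seq beta'_ m | m <- iota 2 (q2 - 3)] ++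
  [seq alpha mu | mu <- iota 1 (q2 - 1)] ++
  [:: sopp gamma; beta'; gamma'].

Definition delta (mu : nat) : svec :=
  [:: (mu, x4); ((mu + 1)%N, - x2); ((3 * q2 - 6 + mu)%N, - x1);
      ((3 * q2 - 5 + mu)%N, x3)].
Definition xi : svec :=
  [:: (1%N, x2 ^+ 2); ((2 * q2 - 3)%N, x2 * x4 ^+ 2);
      ((4 * q2 - 7)%N, x1 * x4 ^+ 2); ((4 * q2 - 6)%N, x4 ^+ 3);
      ((4 * q2 - 5)%N, - x1); ((4 * q2 - 4)%N, x3)].
Definition zeta : svec :=
  [:: ((q2 - 1)%N, x1); (q2, x4); ((2 * q2 - 3)%N, x3);
      ((2 * q2 - 2)%N, x2); ((4 * q2 - 6)%N, x1)].
Definition eta : svec :=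
  [:: ((2 * q2 - 4)%N, - x1); ((3 * q2 - 6)%N, - x3);
      ((3 * q2 - 5)%N, x2 ^+ 2); ((4 * q2 - 5)%N, - x4);
      ((4 * q2 - 4)%N, x2)].
Definition kappa (mu : nat) : svec :=
  [:: ((q2 - 1 + mu)%N, - x1); ((q2 + mu)%N, x4);
      ((2 * q2 - 3 + mu)%N, - x3); ((2 * q2 - 2 + mu)%N, x2)].

Definition Pcols : seq svec :=
  [seq delta mu | mu <- iota 1 (q2 - 2)] ++ [:: xi; zeta; eta] ++
  [seq kappa mu | mu <- iota 1 (q2 - 4)].

Lemma size_gens : (4 <= q2)%N -> size gens = (2 * q2)%N.
Proof. by rewrite /gens !size_cat !size_map !size_iota /=; lia. Qed.

Lemma size_Ncols : (4 <= q2)%N -> size Ncols = (4 * (q2 - 1))%N.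
Proof. by rewrite /Ncols !size_cat !size_map !size_iota /=; lia. Qed.

Lemma size_Pcols : (4 <= q2)%N -> size Pcols = (2 * q2 - 3)%N.
Proof. by rewrite /Pcols !size_cat !size_map !size_iota /=; lia. Qed.

Definition gens_row : 'M[R]_(1, 2 * q2) := \row_j nth 0 gens j.

Definition N_mx : 'M[R]_(2 * q2, 4 * (q2 - 1)) := matrix_of_cols _ _ Ncols.

Definition P_mx : 'M[R]_(4 * (q2 - 1), 2 * q2 - 3) := matrix_of_cols _ _ Pcols.

Definition res_rank (i : nat) : nat :=
  match i with
  | 0 => 1
  | 1 => 2 * q2
  | 2 => 4 * (q2 - 1)
  | 3 => 2 * q2 - 3
  | _ => 0
  end.

Definition res_dif (i : nat) : 'M[R]_(res_rank i, res_rank i.+1) :=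
  match i with
  | 0 => gens_row
  | 1 => N_mx
  | 2 => P_mx
  | _ => 0
  end.

(* 0 -> R^(2q2-3) -> R^(4(q2-1)) -> R^(2q2) -> R -> R/I -> 0, the last map
   being the canonical projection. *)
Definition res_complex : free_complex k 4 :=
  @FreeComplex k 4 res_rank (const_mx 1 : 'rV[R]_1) res_dif.

End Family.

(* Main.v *)
Require Import Defs.
From mathcomp Require Import all_boot all_order all_algebra.
From mathcomp Require Import zify ring.
From Stdlib Require Import Zify ClassicalEpsilon.

(** Write q for q2. A monomial is standard when no lexicographic leading monomial
    of S divides it, that is, when c d = 0, a + c <= q - 2 and b + c <= q - 1 for
    the exponents (a, b, c, d) of x1, ..., x4. Its degree determines b + c modulo q,
    then 2 (a + c) modulo the odd number q - 1, and finally d - c, because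
    n3 + n4 = n1 + n2. So distinct standard monomials have distinct images in k[t],
    and a polynomial of the toric ideal that is supported on them vanishes. This
    gives both the generation of p and the Groebner basis.

    Exactness of the complex: equip each free module with a linear rank for which
    every column of the incoming matrix has a unique term of maximal rank, its
    lead. Subtracting columns, a syzygy can be reduced to one whose terms are not
    divisible by these leads. On such vectors the outgoing matrix has pairwise
    distinct leads, hence is injective, so the reduced syzygy is zero.

    The entries of the matrices have no constant term. Thus no generator is
    redundant, and comparing an arbitrary resolution with this one through chain
    maps and homotopies, then evaluating at the origin, yields the Betti numbers. *)

Set Implicit Arguments.
Unset Strict Implicit.
Unset Printing Implicit Defensive.

(** * Ideals of a polynomial ring *)

Section Ideals.
Import GRing.Theory.
Local Open Scope ring_scope.
Variables (k : fieldType) (n : nat).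
Local Notation R := {mpoly k[n]}.
Implicit Types (A I : R -> Prop) (f g : R).

Definition is_ideal I := [/\ I 0, forall f g, I f -> I g -> I (f + g)
  & forall f g, I g -> I (f * g)].

Lemma ideal_sum I (T : Type) (s : seq T) (P : pred T) (F : T -> R) :
  is_ideal I -> (forall i, P i -> I (F i)) -> I (\sum_(i <- s | P i) F i).
Proof. by case=> I0 ID IM H; elim/big_ind: _. Qed.

Lemma ideal_genP A : is_ideal (ideal_gen A) /\ forall f, A f -> ideal_gen A f.
Proof.
split; last first.
  move=> f Af; exists 1%N, (fun=> 1), (fun=> f); split=> //.
  by rewrite big_ord1 mul1r.
split.
- by exists 0%N, (fun=> 0), (fun=> 0); split; [case | rewrite big_ord0].
- move=> f g [m1 [a1 [b1 [A1 ->]]]] [m2 [a2 [b2 [A2 ->]]]].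
  exists (m1 + m2)%N.
  exists (fun i => match split i with inl j => a1 j | inr j => a2 j end).
  exists (fun i => match split i with inl j => b1 j | inr j => b2 j end).
  split; first by move=> i; case: (split i).
  rewrite big_split_ord /=; congr (_ + _); apply: eq_bigr => i _.
    by rewrite (unsplitK (inl i)).
  by rewrite (unsplitK (inr i)).
- move=> f g [m [a [b [Ab ->]]]]; exists m, (fun i => f * a i), b.
  by split=> //; rewrite mulr_sumr; apply: eq_bigr => i _; rewrite mulrA.
Qed.

Lemma ideal_gen_min A I :
  is_ideal I -> (forall f, A f -> I f) -> forall f, ideal_gen A f -> I f.
Proof.
move=> idI AI f [m [a [b [Ab ->]]]]; apply: ideal_sum => // i _.
by case: idI => _ _; apply; apply: AI.
Qed.

(** Every monomial in the support has a nonzero exponent, so a variable can be split off from it. *)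
Lemma max_idealP f : f@_0 = 0 -> max_ideal f.
Proof.
move=> f0; have [[I0 ID IM] IA] :=
  ideal_genP (fun f => exists i : 'I_n, f = ('X_i : R)).
rewrite (mpolyE f) big_seq; apply: ideal_sum => // m mf.
have [i mi] : exists i, m i != 0%N.
  apply/existsP; rewrite -negb_forall; apply/negP => /forallP m0.
  move: mf; rewrite mcoeff_msupp (_ : m = 0%MM) ?f0 ?eqxx //.
  by apply/mnmP => i; rewrite mnm0E; apply/eqP.
have -> : m = (m - U_(i) + U_(i))%MM.
  by rewrite submK //; apply/mnm_lepP => j; rewrite mnm1E; case: eqP => // <-; lia.
by rewrite mpolyXD scalerAl; apply: IM; apply: IA; exists i.
Qed.

End Ideals.

(** * Reduction and injectivity by means of the leads of matrix columns *)

Section Leads.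
Import GRing.Theory.
Local Open Scope ring_scope.
Variables (k : fieldType) (n : nat).
Local Notation R := {mpoly k[n]}.

Lemma weightD w (m1 m2 : 'X_{1..n}) :
  weight w (m1 + m2)%MM = (weight w m1 + weight w m2)%N.
Proof.
by rewrite /weight -big_split; apply: eq_bigr => i _; rewrite mnmDE mulnDl.
Qed.

Variables (r s : nat) (A : 'M[R]_(r, s)).
(* The monomial [m e_a] of [R^r] has rank [sh a + weight w m]. *)
Variables (w : 'I_n -> nat) (sh : 'I_r -> nat).
Variables (li : 'I_s -> 'I_r) (lm : 'I_s -> 'X_{1..n}).

(** Only the lead has to beat the other terms of its column; those may tie among themselves. So a
    numerical rank serves in place of a total monomial order on the free module. *)
Definition lead_columns := forall b, (A (li b) b)@_(lm b) != 0 /\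
  forall a m, m \in msupp (A a b) -> (a, m) != (li b, lm b) ->
    (sh a + weight w m < sh (li b) + weight w (lm b))%N.

Definition supported t (v : 'cV[R]_t) (Q : 'I_t -> 'X_{1..n} -> Prop) :=
  forall a m, m \in msupp (v a 0) -> Q a m.

Definition irreducible a (m : 'X_{1..n}) :=
  forall b, li b = a -> ~~ (lm b <= m)%MM.

Lemma supportedD t Q (u v : 'cV[R]_t) :
  supported u Q -> supported v Q -> supported (u + v) Q.
Proof.
move=> Hu Hv a m; rewrite mxE => /msuppD_le; rewrite mem_cat.
by case/orP; [apply: Hu | apply: Hv].
Qed.

Lemma col_sum_terms t (v : 'cV[R]_t) : v = \sum_a \sum_(m <- msupp (v a 0))
  ((v a 0)@_m *: 'X_[m]) *: delta_mx a 0.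
Proof.
apply/colP => i; rewrite summxE (bigD1 i) //= [X in _ + X]big1 => [|j ji].
  rewrite addr0 {1}(mpolyE (v i 0)) summxE; apply: eq_bigr => m _.
  by rewrite !mxE !eqxx mulr1.
rewrite summxE big1 // => m _; rewrite !mxE eq_sym (negPf ji) /=.
by rewrite mulr0.
Qed.

Hypothesis leadA : lead_columns.

Lemma column_multiple_supp b c m a m' :
  m' \in msupp ((A *m ((c *: 'X_[m]) *: delta_mx b 0 : 'cV_s)) a 0) ->
  exists2 m0, m0 \in msupp (A a b) & m' = (m + m0)%MM.
Proof.
rewrite -scalemxAr -colE !mxE -scalerAl => /msuppZ_le.
by rewrite mulrC (perm_mem (msuppMX _ _)) => /mapP [m0 m0A ->]; exists m0.
Qed.

Section Reduce.
(* An extra invariant that is preserved when a lead is replaced by the other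
   terms of its column. *)
Variable Q : 'I_r -> 'X_{1..n} -> Prop.
Hypothesis closedQ : forall b m a m', Q (li b) (m + lm b)%MM ->
  m' \in msupp (A a b) -> Q a (m + m')%MM.

Definition reducible (v : 'cV[R]_r) := exists u,
  supported (v - A *m u) (fun a m => irreducible a m /\ Q a m).

Lemma reducibleD u v : reducible u -> reducible v -> reducible (u + v).
Proof.
move=> [u' Hu] [v' Hv]; exists (u' + v').
rewrite mulmxDr opprD addrACA; exact: supportedD.
Qed.

Lemma reducible_sum (T : Type) (l : seq T) (P : pred T) (F : T -> 'cV[R]_r) :
  (forall i, P i -> reducible (F i)) -> reducible (\sum_(i <- l | P i) F i).
Proof.
move=> H; elim/big_ind: _ => //; last exact: reducibleD.
by exists 0 => a m; rewrite mulmx0 subr0 mxE msupp0.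
Qed.

(** Induction on a bound for the ranks, one term at a time since [reducible] is additive. A term
    divisible by a lead is cancelled by a multiple of that column, whose other terms have smaller
    rank. *)
Lemma reduce v : supported v Q -> reducible v.
Proof.
suff H N (u : 'cV_r) : supported u Q ->
    supported u (fun a m => sh a + weight w m < N)%N -> reducible u.
  move=> vQ; pose F a := (\max_(m <- msupp (v a 0%R)) (sh a + weight w m)%N).
  apply: (H (\max_a F a).+1) => // a m mv; rewrite ltnS.
  apply: leq_trans (leq_bigmax a); exact: (@leq_bigmax_seq _ _ xpredT).
elim: N u => [|N IH] u uQ uN.
  exists 0; rewrite mulmx0 subr0 => a m /uN; lia.
rewrite (col_sum_terms u); apply: reducible_sum => a _.
rewrite big_seq; apply: reducible_sum => m mu.
have Qm := uQ _ _ mu; have Nm := uN _ _ mu; set c := (u a 0)@_m.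
have term_supp a' m' :
    m' \in msupp (((c *: 'X_[m]) *: delta_mx a 0 : 'cV_r) a' 0) ->
    a' = a /\ m' = m.
  rewrite !mxE eqxx andbT; case: eqP => [->|_]; last by rewrite mulr0 msupp0.
  rewrite mulr1 => /msuppZ_le; rewrite msuppX inE => /eqP ->; by [].
have [b /andP[/eqP ba lmm] | irr] :=
    pickP (fun b => (li b == a) && (lm b <= m)%MM); last first.
  exists 0; rewrite mulmx0 subr0 => a' m' /term_supp [-> ->]; split=> // b ba.
  by have := irr b; rewrite ba eqxx /= => ->.
have [lc0 lcmax] := leadA b.
(* With this scalar the lead of [A *m x] is exactly the term to be cancelled. *)
pose d := c / (A (li b) b)@_(lm b).
pose x : 'cV[R]_s := (d *: 'X_[m - lm b]) *: delta_mx b 0.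
have mE : m = ((m - lm b) + lm b)%MM by rewrite submK.
set y := _ *: delta_mx a 0; rewrite (_ : y = y - A *m x + A *m x); last first.
  by rewrite subrK.
apply: reducibleD; last first.
  by exists x; rewrite subrr => a' m'; rewrite mxE msupp0.
have supp_sub a' m' : m' \in msupp ((y - A *m x) a' 0) ->
    Q a' m' /\ (sh a' + weight w m' < N)%N.
  move=> m'v.
  have : m' \in msupp (y a' 0) ++ msupp ((A *m x) a' 0).
    by apply: msuppB_le; move: m'v; rewrite !mxE.
  have [/eqP [ea em] _|ne] := boolP ((a', m') == (a, m)).
    move: m'v; rewrite mcoeff_msupp ea em => /eqP; case.
    have -> : (y - A *m x) a 0 = c *: 'X_[m] - d *: (A a b * 'X_[m - lm b]).
      rewrite !mxE eqxx mulr1 [A a b * _]mulrC scalerAl; congr (_ - _).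
      by rewrite /x -[RHS]mulrC (bigD1 b) //= big1 ?addr0 => [|i ib];
        rewrite !mxE ?eqxx ?(negPf ib) ?mulr1 ?mulr0.
    have := mcoeffMX (A a b) (m - lm b)%MM (lm b); rewrite -mE => cA.
    by rewrite mcoeffB !mcoeffZ mcoeffX eqxx mulr1 cA /d ba divfK ?subrr // -ba.
  rewrite mem_cat => /orP [/term_supp [ea em]|]; first by rewrite ea em eqxx in ne.
  case/column_multiple_supp=> m0 m0A em; split.
    by rewrite em; apply: closedQ m0A; rewrite -mE ba.
  have ne0 : (a', m0) != (li b, lm b).
    by apply: contra ne => /eqP [-> e0]; rewrite ba em e0 -mE.
  have := lcmax a' m0 m0A ne0; have := weightD w (m - lm b)%MM (lm b).
  by rewrite -mE ba em weightD; lia.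
by apply: IH => a' m' /supp_sub [].
Qed.

End Reduce.

(** Take a term of [v] whose product with its column lead has maximal rank. No other term of [v]
    contributes to that monomial of [A *m v]: products with non-leading terms have smaller rank, and
    a coincidence of leads is excluded by the first hypothesis. So the coefficient there is
    nonzero. *)
Lemma leads_inj (Y : 'I_s -> 'X_{1..n} -> Prop) (v : 'cV[R]_s) :
  (forall b b' m m', Y b m -> Y b' m' -> li b = li b' ->
     (lm b + m = lm b' + m')%MM -> b = b') ->
  supported v Y -> A *m v = 0 -> v = 0.
Proof.
move=> injY vY Av0; apply/colP => b0; rewrite mxE; apply/eqP.
rewrite -msupp_eq0 -size_eq0 eqn0Ngt; apply/negP; rewrite -has_predT => /hasP [m0 m0v _].
pose rk b (m : 'X_{1..n}) := (sh (li b) + weight w (lm b + m))%N.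
pose N := \max_b \max_(m <- msupp (v b 0%R)) rk b m.
have rkN b m : m \in msupp (v b 0) -> (rk b m <= N)%N.
  move=> mv; apply: leq_trans (leq_bigmax b).
  exact: (@leq_bigmax_seq _ _ xpredT).
(* Induction on the distance to the maximal rank: a term of higher rank is refuted by [IH], so
   [rk b m] may be assumed maximal, which is [rkle]. *)
have [d] := ubnP (N - rk b0 m0); elim: d b0 m0 m0v => // d IH b m mv dN.
have [lc0 lcmax] := leadA b.
have rkle b' m' : m' \in msupp (v b' 0) -> (rk b' m' <= rk b m)%N.
  move=> m'v; rewrite leqNgt; apply/negP => lt.
  by apply: (IH _ _ m'v); have := rkN _ _ m'v; lia.
have other b' m' c : m' \in msupp (v b' 0) -> (b', m') != (b, m) ->
    ((A *m ((c *: 'X_[m']) *: delta_mx b' 0 : 'cV_s)) (li b) 0)@_(lm b + m) = 0.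
  move=> m'v ne; apply/eqP; rewrite mcoeff_eq0; apply/negP.
  case/column_multiple_supp => m1 m1A em.
  have [_ /(_ _ _ m1A)] := leadA b'.
  case: eqP => [[el e1] _|_ /(_ isT)].
    have eb : b = b' by apply: (injY _ _ m m') => //; [exact: vY|exact: vY|rewrite em e1 addmC].
    have /addmI em' : (lm b + m = lm b + m')%MM by rewrite em e1 -eb addmC.
    by rewrite eb em' eqxx in ne.
  by have := rkle _ _ m'v; rewrite /rk em !weightD; lia.
have := congr1 (fun f : 'cV_r => (f (li b) 0)@_(lm b + m)) Av0.
rewrite /= [v in _ *m v]col_sum_terms mulmx_sumr summxE linear_sum /=.
rewrite (bigD1 b) //= [X in _ + X]big1 ?addr0 => [|b' ne]; last first.
  rewrite mulmx_sumr summxE linear_sum big_seq big1 //= => m' m'v.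
  by rewrite other // xpair_eqE (negPf ne).
rewrite mulmx_sumr summxE linear_sum (bigD1_seq m) ?msupp_uniq //=.
rewrite big_seq_cond big1 ?addr0 => [|m' /andP[m'v ne]]; last first.
  by rewrite other // xpair_eqE (negPf ne) andbF.
rewrite -scalemxAr -colE !mxE mcoeff0 -scalerAl mcoeffZ mulrC.
rewrite ['X_[m] * _]mulrC [(lm b + m)%MM]addmC mcoeffMX => /eqP; rewrite mulf_eq0 (negPf lc0) /=.
by move: mv; rewrite mcoeff_msupp => /negPf ->.
Qed.

End Leads.

(** * Comparison of free resolutions and Betti numbers *)

Section Betti.
Import GRing.Theory.
Local Open Scope ring_scope.

Section Lift.
Variables (S : pzRingType).

Lemma exists_lift a b c (D : 'M[S]_(a, b)) (M : 'M[S]_(a, c)) :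
  (forall j, exists w, col j M = D *m w) -> exists W, M = D *m W.
Proof.
move=> /fin_all_exists [f fP]; exists (\matrix_(i, j) f j i 0).
apply/matrixP => i j; have /colP /(_ i) := fP j; rewrite !mxE => ->.
by apply: eq_bigr => l _; rewrite mxE.
Qed.

(** Choice by [epsilon] makes the lift a total function, so that chain maps and homotopies are plain
    recursive definitions whose equations are proved afterwards. *)
Definition lift_mx a b c (D : 'M[S]_(a, b)) (M : 'M[S]_(a, c)) : 'M[S]_(b, c) :=
  epsilon (inhabits 0) (fun W => M = D *m W).

Lemma lift_mxP a b c (D : 'M[S]_(a, b)) (M : 'M[S]_(a, c)) :
  (forall u : 'cV_c, exists w, M *m u = D *m w) -> M = D *m lift_mx D M.
Proof.
move=> H; apply: (@epsilon_spec _ (inhabits 0) (fun W => M = D *m W)).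
by apply: exists_lift => j; have [w] := H (delta_mx j 0); rewrite -colE; exists w.
Qed.

End Lift.

(** By the homotopy identity, the kernel of [A] is the sum of the images of [A'] and [psi]. Since
    [phi] kills the first and is a left inverse of [psi], the sum is direct and [psi] has rank [g].
    The proof transposes because matrix spaces are row spaces. *)
Lemma splitting_dim (K : fieldType) a b c g (A : 'M[K]_(a, b)) (A' : 'M[K]_(b, c))
    (phi : 'M[K]_(g, b)) (psi : 'M[K]_(b, g)) s s' :
  A *m A' = 0 -> A *m psi = 0 -> phi *m A' = 0 -> phi *m psi = 1%:M ->
  1%:M - psi *m phi = s *m A + A' *m s' ->
  (\rank (cokermx A) - \rank A')%N = g.
Proof.
move=> AA' Apsi phiA' phipsi hs.
have ker : (A'^T + psi^T == kermx A^T)%MS.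
  apply/andP; split.
    rewrite addsmx_sub; apply/andP; split; apply/sub_kermxP.
      by rewrite -trmx_mul AA' trmx0.
    by rewrite -trmx_mul Apsi trmx0.
  apply/row_subP => i; set u := row i _.
  have uA : u *m A^T = 0 by apply/sub_kermxP; exact: row_sub.
  have -> : u = u *m (s'^T *m A'^T) + u *m (phi^T *m psi^T).
    rewrite -!trmx_mul; have /(canRL (subrK _)) h := hs.
    rewrite -mulmxDr -linearD /=.
    have -> : A' *m s' + psi *m phi = 1%:M - s *m A.
      by rewrite h; apply/matrixP => x y; rewrite !mxE; ring.
    by rewrite linearB /= trmx1 mulmxBr mulmx1 trmx_mul mulmxA uA mul0mx subr0.
  by rewrite addmx_sub_adds // mulmxA submxMl.
have dir : (A'^T :&: psi^T = 0)%MS.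
  apply/eqP; rewrite -submx0; apply/row_subP => i.
  have : (row i (A'^T :&: psi^T) <= A'^T :&: psi^T)%MS by exact: row_sub.
  rewrite sub_capmx => /andP [/submxP [x ->] /submxP [y xy]].
  have : x *m A'^T *m phi^T = y by rewrite xy -mulmxA -trmx_mul phipsi trmx1 mulmx1.
  by rewrite -mulmxA -trmx_mul phiA' trmx0 mulmx0 => y0; rewrite xy -y0 mul0mx sub0mx.
have rpsi : \rank psi^T = g.
  apply/eqP; rewrite eqn_leq rank_leq_row /= -[X in (X <= _)%N](mxrank1 K).
  by rewrite -trmx1 -phipsi trmx_mul mxrankM_maxl.
have := mxrank_sum_cap A'^T psi^T; rewrite dir mxrank0 addn0 rpsi mxrank_tr.
by rewrite (eqmxP ker) mxrank_ker mxrank_coker mxrank_tr; lia.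
Qed.

Variables (k : fieldType) (n : nat).
Local Notation R := {mpoly k[n]}.
Variable I : R -> Prop.
Hypothesis idI : is_ideal I.
Implicit Types F G : free_complex k n.

(** The matrix [p0] covers the identity of $R/I$; the row [aug] stands for a map to this quotient,
    hence the congruence modulo [I]. *)
Definition compatible F G (p0 : 'M[R]_(rk G 0, rk F 0)) :=
  forall u : 'cV_(rk F 0), I ((aug F *m u) 0 0 - (aug G *m (p0 *m u)) 0 0).

Lemma dif_dif F i : free_resolution I F -> dif F i *m dif F i.+1 = 0.
Proof.
case=> _ _ ex; apply/matrixP => a b.
have /colP /(_ a) : dif F i *m (dif F i.+1 *m (delta_mx b 0 : 'cV_ _)) = 0.
  by apply/ex; exists (delta_mx b 0).
by rewrite mulmxA -colE 2!mxE => ->; rewrite !mxE.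
Qed.

Lemma exists_compatible F G : free_resolution I G -> exists p0, @compatible F G p0.
Proof.
case=> sur _ _; case: idI => I0 ID IM.
have /fin_all_exists [f fP] b : exists v : 'cV_(rk G 0), I (aug F 0 b - (aug G *m v) 0 0).
  exact: sur.
exists (\matrix_(i, j) f j i 0) => u.
rewrite mulmxA !mxE -sumrB; apply: (ideal_sum _ idI) => b _.
rewrite -mulrBl mulrC; apply: IM; move: (fP b); rewrite !mxE.
by under [X in _ -> I (_ - X)]eq_bigr => j _ do rewrite mxE.
Qed.

Fixpoint chain_map F G (p0 : 'M[R]_(rk G 0, rk F 0)) i : 'M[R]_(rk G i, rk F i) :=
  if i is j.+1 then lift_mx (dif G j) (chain_map p0 j *m dif F j) else p0.

(** The comparison theorem: by exactness of [G], each composite [chain_map p0 i *m dif F i] factors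
    through [dif G i]. *)
Lemma chain_mapP F G p0 : free_resolution I F -> free_resolution I G ->
  @compatible F G p0 ->
  forall i, chain_map p0 i *m dif F i = dif G i *m chain_map p0 i.+1.
Proof.
move=> resF resG cp; case: (idI) => I0 ID IM.
have [_ exF0 exF] := resF; have [_ exG0 exG] := resG.
elim=> [|i IH]; apply: lift_mxP => u.
  apply/exG0; rewrite -mulmxA; set v := dif F 0 *m u.
  have Iv : I ((aug F *m v) 0 0) by apply/exF0; exists u.
  have -> : (aug G *m (p0 *m v)) 0 0 =
     (aug F *m v) 0 0 + (-1) * ((aug F *m v) 0 0 - (aug G *m (p0 *m v)) 0 0) by ring.
  by apply: ID => //; apply: IM; apply: cp.
by apply/exG; rewrite !mulmxA -IH -[X in X *m u]mulmxA dif_dif // mulmx0 mul0mx.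
Qed.

Fixpoint homotopy F (chi : forall i, 'M[R]_(rk F i, rk F i)) i : 'M[R]_(rk F i.+1, rk F i) :=
  lift_mx (dif F i) (chi i - if i is j.+1 then homotopy chi j *m dif F j else 0).

(** A chain map inducing zero on $R/I$ is null-homotopic: what the previous homotopy leaves over
    lies in a kernel, and exactness lifts it. *)
Lemma homotopyP F chi : free_resolution I F ->
  (forall i, chi i *m dif F i = dif F i *m chi i.+1) ->
  (forall u : 'cV_(rk F 0), I ((aug F *m (chi 0%N *m u)) 0 0)) ->
  forall i, chi i.+1 =
    homotopy chi i *m dif F i + dif F i.+1 *m homotopy chi i.+1.
Proof.
move=> resF chiP chi0; have [_ ex0 ex] := resF.
have h0 : chi 0%N = dif F 0 *m homotopy chi 0.
  by rewrite /= subr0; apply: lift_mxP => u; apply/ex0.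
elim=> [|i IH]; apply/eqP; rewrite addrC -subr_eq; apply/eqP;
  apply: lift_mxP => u; apply/ex; rewrite mulmxA mulmxBr -chiP.
  by rewrite h0 mulmxA subrr mul0mx.
by rewrite IH mulmxDl -!mulmxA dif_dif // !mulmx0 add0r subrr mul0mx.
Qed.

(** The comparison maps in both directions compose to maps homotopic to the identity. At the origin
    the differentials of [G] vanish, so the composite on [G] becomes the identity itself and
    [splitting_dim] applies. *)
Lemma homology_minimal F G i : free_resolution I F -> free_resolution I G ->
  minimal G -> homology_dim F i.+1 = rk G i.+1.
Proof.
move=> resF resG minG; case: (idI) => I0 ID IM.
have [p0 cp] := exists_compatible F resG; have [q0 cq] := exists_compatible G resF.
have phiP := chain_mapP resF resG cp; have psiP := chain_mapP resG resF cq.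
set phi := chain_map p0 in phiP; set psi := chain_map q0 in psiP.
pose chiF j := 1%:M - psi j *m phi j; pose chiG j := 1%:M - phi j *m psi j.
have hF : forall j, chiF j.+1 =
    homotopy chiF j *m dif F j + dif F j.+1 *m homotopy chiF j.+1.
  apply: homotopyP => // [j|u].
    by rewrite mulmxBl mulmxBr mul1mx mulmx1 -mulmxA phiP !mulmxA psiP.
  have := ID _ _ (cp u) (cq (p0 *m u)); rewrite /chiF /= mulmxBl mulmxBr mul1mx.
  by rewrite addrA subrK [X in _ -> I X]mxE [X in _ -> I (_ + X)]mxE !mulmxA.
have hG : forall j, chiG j.+1 =
    homotopy chiG j *m dif G j + dif G j.+1 *m homotopy chiG j.+1.
  apply: homotopyP => // [j|u].
    by rewrite mulmxBl mulmxBr mul1mx mulmx1 -mulmxA psiP !mulmxA phiP.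
  have := ID _ _ (cq u) (cp (q0 *m u)); rewrite /chiG /= mulmxBl mulmxBr mul1mx.
  by rewrite addrA subrK [X in _ -> I X]mxE [X in _ -> I (_ + X)]mxE !mulmxA.
have G0 j : map_mx (meval (fun=> 0)) (dif G j) = 0 :> 'M[k]_(_, _).
  apply/matrixP => a b; rewrite !mxE; move: (dif G j a b) (minG j a b).
  apply: ideal_gen_min => [|f [l ->]]; last by rewrite mevalXU.
  split=> [|f g f0 g0|f g g0]; first by rewrite meval0.
    by rewrite mevalD f0 g0 addr0.
  by rewrite mevalM g0 mulr0.
pose evm a b (M : 'M[R]_(a, b)) := map_mx (meval (fun=> 0)) M : 'M[k]_(a, b).
have evP a b (M N : 'M[R]_(a, b)) : M = N -> evm _ _ M = evm _ _ N by move->.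
apply: (@splitting_dim _ _ _ _ _ _ _ (evm _ _ (phi i.+1)) (evm _ _ (psi i.+1))
  (evm _ _ (homotopy chiF i)) (evm _ _ (homotopy chiF i.+1))); rewrite /dif_residue /evm -?map_mxM.
- by rewrite dif_dif // map_mx0.
- by rewrite -psiP map_mxM G0 mulmx0.
- by rewrite phiP map_mxM G0 mul0mx.
- have := evP _ _ _ _ (hG i); rewrite /evm /chiG map_mxB map_mxD !map_mxM !G0 map_mx1.
  by rewrite mul0mx mulmx0 addr0 => /subr0_eq ->.
- by have := evP _ _ _ _ (hF i); rewrite /chiF /evm map_mxB map_mxD map_mx1 !map_mxM.
Qed.

Lemma betti_minimal G i : free_resolution I G -> minimal G -> betti I i.+1 (rk G i.+1).
Proof. by move=> resG minG; split=> [|F resF]; [exists G | apply: homology_minimal]. Qed.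

End Betti.

Ltac ifs := repeat match goal with |- context [if ?b then _ else _] =>
  first [have -> : b = true by lia | have -> : b = false by lia]; cbv iota end.

(** * The identities $GN = 0$ and $NP = 0$, column by column *)

Section Columns.
Import GRing.Theory.
Local Open Scope ring_scope.
Variables (k : fieldType) (q : nat).
Local Notation R := {mpoly k[4]}.
Hypothesis hq : (4 <= q)%N.
Implicit Type c : svec k.

Local Notation coord := (@Defs.coord k).
Local Notation x1 := (x1 k).
Local Notation x2 := (x2 k).
Local Notation x3 := (x3 k).
Local Notation x4 := (x4 k).

(** The indicators [(p.1 == i)%:R] are atoms for [ring], so an identity between sparse columns is
    checked at all coordinates at once. *)
Lemma coordE c i : coord c i = \sum_(p <- c) p.2 * (p.1 == i)%:R.
Proof.
by rewrite /coord big_mkcond; apply: eq_bigr => p _; case: eqP; rewrite ?mulr1 ?mulr0.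
Qed.

(** Reduces an entry of a matrix product to the few listed entries of a sparse column; [.-1] passes
    from coordinates counted from 1 to positions counted from 0. *)
Lemma sum_coord r (F : nat -> R) c : all (fun p => 0 < p.1 <= r)%N c ->
  \sum_(i < r) F i * coord c i.+1 = \sum_(p <- c) F p.1.-1 * p.2.
Proof.
move=> /allP cr; under eq_bigr => i _ do rewrite coordE mulr_sumr.
rewrite exchange_big /= !big_seq; apply: eq_bigr => p /cr /andP [p0 pr].
have ltp : (p.1.-1 < r)%N by rewrite prednK.
rewrite (bigD1 (Ordinal ltp)) //= prednK // eqxx mulr1 big1 ?addr0 // => i.
move=> /eqP ne; case: eqP => [e|]; last by rewrite !mulr0.
by case: ne; apply: val_inj; rewrite /= e.
Qed.

Lemma nth_gens_f j mu : (0 < mu <= q)%N -> j = mu.-1 -> nth 0 (gens k q) j = f_ k q mu.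
Proof.
move=> h ->; rewrite nth_cat size_map size_iota ifT; last by lia.
by rewrite (nth_map 0%N) ?size_iota ?nth_iota; try lia; congr f_; lia.
Qed.

Lemma nth_gens_g1 j : j = q -> nth 0 (gens k q) j = g1 k q.
Proof. by move=> ->; rewrite nth_cat size_map size_iota ltnn subnn. Qed.

Lemma nth_gens_g2 j : j = q.+1 -> nth 0 (gens k q) j = g2 k.
Proof. by move=> ->; rewrite nth_cat size_map size_iota ltnNge leqnSn subSnn. Qed.

Lemma nth_gens_h j m : (0 < m <= q - 2)%N -> j = (q + m).+1 -> nth 0 (gens k q) j = h_ k q m.
Proof.
move=> h ->; rewrite nth_cat size_map size_iota ifF; last by lia.
rewrite nth_cat ifF; last by rewrite /=; lia.
rewrite (nth_map 0%N) ?size_iota /= ?nth_iota; try lia; congr h_; lia.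
Qed.

Let col0 : svec k := [::].
Local Notation NC := (Ncols k q).
Local Notation PC := (Pcols k q).

Lemma nth_Ncols j : (j < 4 * (q - 1))%N -> nth col0 NC j =
  if (j < q - 1)%N then beta k q j.+1 else
  if (j < 2 * q - 4)%N then gamma'_ k q (j - (q - 1)).+1 else
  if j == (2 * q - 4)%N then alpha' k q else
  if (j < 3 * q - 6)%N then beta'_ k q (j - (2 * q - 5)) else
  if (j < 4 * q - 7)%N then alpha k q (j - (3 * q - 6)).+1 else
  if j == (4 * q - 7)%N then sopp (gamma k q) else
  if j == (4 * q - 6)%N then beta' k q else gamma' k q.
Proof.
move=> jq; rewrite nth_cat size_map size_iota.
case: ltnP => h1; first by rewrite (nth_map 0%N) ?size_iota ?nth_iota //; congr beta; lia.
rewrite nth_cat size_map size_iota (_ : (_ < q - 3) = (j < 2 * q - 4))%N; last by lia.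
case: ltnP => h2; first by rewrite (nth_map 0%N) ?size_iota ?nth_iota; try lia; congr gamma'_; lia.
rewrite nth_cat /= (_ : (_ < 1)%N = (j == 2 * q - 4)%N); last by lia.
case: eqP => h3; first by rewrite h3 (_ : (_ - _)%N = 0%N) //; lia.
rewrite nth_cat size_map size_iota (_ : (_ < q - 3) = (j < 3 * q - 6))%N; last by lia.
case: ltnP => h4; first by rewrite (nth_map 0%N) ?size_iota ?nth_iota; try lia; congr beta'_; lia.
rewrite nth_cat size_map size_iota (_ : (_ < q - 1) = (j < 4 * q - 7))%N; last by lia.
case: ltnP => h5; first by rewrite (nth_map 0%N) ?size_iota ?nth_iota; try lia; congr alpha; lia.
case: eqP => h6; first by rewrite h6 (_ : (_ - (q - 1))%N = 0%N) //; lia.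
case: eqP => h7; first by rewrite h7 (_ : (_ - (q - 1))%N = 1%N) //; lia.
by rewrite (_ : (_ - (q - 1))%N = 2%N) //; lia.
Qed.

Lemma nth_Pcols j : (j < 2 * q - 3)%N -> nth col0 PC j =
  if (j < q - 2)%N then delta k q j.+1 else
  if j == (q - 2)%N then xi k q else
  if j == (q - 1)%N then zeta k q else
  if j == q then eta k q else kappa k q (j - q).
Proof.
move=> jq; rewrite nth_cat size_map size_iota.
case: ltnP => h1; first by rewrite (nth_map 0%N) ?size_iota ?nth_iota //; congr delta; lia.
case: eqP => [->|h2]; first by rewrite subnn.
case: eqP => [->|h3]; first by rewrite (_ : (_ - (q - 2))%N = 1%N) //; lia.
case: eqP => [->|h4]; first by rewrite (_ : (_ - (q - 2))%N = 2%N) //; lia.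
rewrite nth_cat ifF /=; last by lia.
by rewrite (nth_map 0%N) ?size_iota ?nth_iota; try lia; congr kappa; lia.
Qed.

(** A property of all columns becomes one symbolic check per family, with the position expressed
    through the index of the family. *)
Lemma Ncols_ind (P : nat -> svec k -> Prop) :
  (forall j mu, (0 < mu < q)%N -> j = mu.-1 -> P j (beta k q mu)) ->
  (forall j m, (0 < m <= q - 3)%N -> j = (q - 2 + m)%N -> P j (gamma'_ k q m)) ->
  (forall j, j = (2 * q - 4)%N -> P j (alpha' k q)) ->
  (forall j m, (2 <= m <= q - 2)%N -> j = (2 * q - 5 + m)%N -> P j (beta'_ k q m)) ->
  (forall j mu, (0 < mu < q)%N -> j = (3 * q - 7 + mu)%N -> P j (alpha k q mu)) ->
  (forall j, j = (4 * q - 7)%N -> P j (sopp (gamma k q))) ->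
  (forall j, j = (4 * q - 6)%N -> P j (beta' k q)) ->
  (forall j, j = (4 * q - 5)%N -> P j (gamma' k q)) ->
  forall j, (j < 4 * (q - 1))%N -> P j (nth col0 NC j).
Proof.
move=> H1 H2 H3 H4 H5 H6 H7 H8 j jq; rewrite nth_Ncols //.
case: ltnP => h1; first by apply: H1; lia.
case: ltnP => h2; first by apply: H2; lia.
case: eqP => h3; first exact: H3.
case: ltnP => h4; first by apply: H4; lia.
case: ltnP => h5; first by apply: H5; lia.
case: eqP => h6; first exact: H6.
case: eqP => h7; first exact: H7.
by apply: H8; lia.
Qed.

Lemma Pcols_ind (P : nat -> svec k -> Prop) :
  (forall j mu, (0 < mu <= q - 2)%N -> j = mu.-1 -> P j (delta k q mu)) ->
  (forall j, j = (q - 2)%N -> P j (xi k q)) ->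
  (forall j, j = (q - 1)%N -> P j (zeta k q)) ->
  (forall j, j = q -> P j (eta k q)) ->
  (forall j mu, (0 < mu <= q - 4)%N -> j = (q + mu)%N -> P j (kappa k q mu)) ->
  forall j, (j < 2 * q - 3)%N -> P j (nth col0 PC j).
Proof.
move=> H1 H2 H3 H4 H5 j jq; rewrite nth_Pcols //.
case: ltnP => h1; first by apply: H1; lia.
case: eqP => h2; first exact: H2.
case: eqP => h3; first exact: H3.
case: eqP => h4; first exact: H4.
by apply: H5; lia.
Qed.

(** Truncated differences are opaque to [ring]; this brings exponents and coordinates to matching
    forms, with successors that [exprS] can unfold. *)
Ltac np n m := rewrite (_ : n%N = m%N); [|lia].
Ltac unf := rewrite /g1 /g2 /f_ /h_ /d1 /q1 /=.

Lemma gens_Ncols j : (j < 4 * (q - 1))%N ->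
  \sum_(p <- nth col0 NC j) nth 0 (gens k q) p.1.-1 * p.2 = 0.
Proof.
move: j; apply: (Ncols_ind (P := fun _ c =>
  \sum_(p <- c) nth 0 (gens k q) p.1.-1 * p.2 = 0)) =>
  [j mu hmu _|j m hm _|j _|j m hm _|j mu hmu _|j _|j _|j _];
  rewrite !big_cons big_nil /= addr0.
- rewrite (@nth_gens_f mu.-1 mu) 1?(@nth_gens_f (mu + 1).-1 (mu + 1))
    1?(@nth_gens_g2 (q + 2).-1); try lia; unf.
  np (q - mu)%N (q - (mu + 1)).+1; np (mu + 1 - 1)%N (mu - 1).+1.
  np (mu + 1 + 1)%N (mu + 1).+1.
  by rewrite !exprS; ring.
- rewrite (@nth_gens_g2 (q + 2).-1) 1?(@nth_gens_h (q + m + 2).-1 m)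
    1?(@nth_gens_h (q + m + 3).-1 m.+1); try lia; unf.
  np (q + 1 - m)%N (q - m).+1; np (q + 1 - m.+1)%N (q - m)%N; np (q - m)%N (q - m.+1).+1.
  by rewrite !exprS; ring.
- rewrite (@nth_gens_f q.-1 q) 1?(@nth_gens_g1 (q + 1).-1) 1?(@nth_gens_g2 (q + 2).-1)
    1?(@nth_gens_h (q + 3).-1 1); try lia; unf.
  np (q - q)%N 0%N; np (q + 1 - 1)%N q; np (q + 1)%N q.+1; rewrite expr0 expr1 mulr1 mul1r.
  have -> : x2 ^+ q = x2 * x2 ^+ (q - 1) by rewrite -exprS; congr (_ ^+ _); lia.
  by rewrite !exprS; ring.
- rewrite (@nth_gens_g2 (q + 2).-1) 1?(@nth_gens_h (q + m + 2).-1 m)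
    1?(@nth_gens_h (q + m + 1).-1 (m - 1)); try lia; unf.
  np (q + 1 - m)%N (q - m).+1; np (q + 1 - (m - 1))%N (q - m).+2; np (q - (m - 1))%N (q - m).+1.
  have [-> ->] : x1 ^+ m = x1 * x1 ^+ (m - 1) /\ x3 ^+ m = x3 * x3 ^+ (m - 1).
    by rewrite -!exprS; split; congr (_ ^+ _); lia.
  by rewrite !exprS; ring.
- rewrite (@nth_gens_f mu.-1 mu) 1?(@nth_gens_f (mu + 1).-1 (mu + 1))
    1?(@nth_gens_g2 (q + 2).-1); try lia; unf.
  np (q - mu)%N (q - (mu + 1)).+1; np (mu + 1 - 1)%N (mu - 1).+1.
  np (mu + 1 + 1)%N (mu + 1).+1.
  by rewrite !exprS; ring.
- rewrite (@nth_gens_f (q - 1).-1 (q - 1)) 1?(@nth_gens_g1 (q + 1).-1)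
    1?(@nth_gens_h (q + 3).-1 1); try lia; unf.
  np (q - (q - 1))%N 1%N; np (q - 1 - 1)%N (q - 2)%N; np (q - 1 + 1)%N q; np (q + 1 - 1)%N q.
  have [-> ->] : x2 ^+ q = x2 * x2 ^+ (q - 1) /\ x1 ^+ (q - 1) = x1 * x1 ^+ (q - 2).
    by rewrite -!exprS; split; congr (_ ^+ _); lia.
  by rewrite !expr1; ring.
- rewrite (@nth_gens_f 0 1) 1?(@nth_gens_g1 (q + 1).-1) 1?(@nth_gens_g2 (q + 2).-1)
    1?(@nth_gens_h (2 * q).-1 (q - 2)); try lia; unf.
  np (q + 1 - (q - 2))%N 3%N; np (q - (q - 2))%N 2%N; np (1 - 1)%N 0%N.
  have [[-> ->] ->] : (x2 ^+ q = x2 * x2 ^+ (q - 1) /\ x1 ^+ (q - 1) = x1 * x1 ^+ (q - 2))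
     /\ x3 ^+ (q - 1) = x3 * x3 ^+ (q - 2).
    by rewrite -!exprS; repeat split; congr (_ ^+ _); lia.
  have -> : x2 ^+ (q - 1) = x2 * x2 ^+ (q - 2) by rewrite -exprS; congr (_ ^+ _); lia.
  by ring.
- rewrite (@nth_gens_f 1 2) 1?(@nth_gens_g1 (q + 1).-1)
    1?(@nth_gens_h (2 * q).-1 (q - 2)); try lia; unf.
  np (q + 1 - (q - 2))%N 3%N; np (q - (q - 2))%N 2%N; np (2 - 1)%N 1%N.
  have [-> ->] : x2 ^+ q = x2 ^+ 2 * x2 ^+ (q - 2) /\ x1 ^+ (q - 1) = x1 * x1 ^+ (q - 2).
    by rewrite -exprD -!exprS; split; congr (_ ^+ _); lia.
  by ring.
Qed.

Lemma nth_Ncols_beta j (mu : nat) : (0 < mu < q)%N -> j = mu.-1 -> nth col0 NC j = beta k q mu.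
Proof. by move=> h ->; rewrite nth_Ncols; [ifs; congr beta; lia | lia]. Qed.

Lemma nth_Ncols_gamma'_ j (m : nat) : (0 < m <= q - 3)%N -> j = (q - 2 + m)%N ->
  nth col0 NC j = gamma'_ k q m.
Proof. by move=> h ->; rewrite nth_Ncols; [ifs; congr gamma'_; lia | lia]. Qed.

Lemma nth_Ncols_alpha' j : j = (2 * q - 4)%N -> nth col0 NC j = alpha' k q.
Proof. by move=> ->; rewrite nth_Ncols; [ifs | lia]. Qed.

Lemma nth_Ncols_beta'_ j (m : nat) : (2 <= m <= q - 2)%N -> j = (2 * q - 5 + m)%N ->
  nth col0 NC j = beta'_ k q m.
Proof. by move=> h ->; rewrite nth_Ncols; [ifs; congr beta'_; lia | lia]. Qed.

Lemma nth_Ncols_alpha j (mu : nat) : (0 < mu < q)%N -> j = (3 * q - 7 + mu)%N ->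
  nth col0 NC j = alpha k q mu.
Proof. by move=> h ->; rewrite nth_Ncols; [ifs; congr alpha; lia | lia]. Qed.

Lemma nth_Ncols_gamma j : j = (4 * q - 7)%N -> nth col0 NC j = sopp (gamma k q).
Proof. by move=> ->; rewrite nth_Ncols; [ifs | lia]. Qed.

Lemma nth_Ncols_beta' j : j = (4 * q - 6)%N -> nth col0 NC j = beta' k q.
Proof. by move=> ->; rewrite nth_Ncols; [ifs | lia]. Qed.

Lemma nth_Ncols_gamma' j : j = (4 * q - 5)%N -> nth col0 NC j = gamma' k q.
Proof. by move=> ->; rewrite nth_Ncols; [ifs | lia]. Qed.

Lemma Ncols_Pcols i j : (j < 2 * q - 3)%N ->
  \sum_(p <- nth col0 PC j) coord (nth col0 NC p.1.-1) i * p.2 = 0.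
Proof.
move: j; apply: (Pcols_ind (P := fun _ c =>
  \sum_(p <- c) coord (nth col0 NC p.1.-1) i * p.2 = 0)) =>
  [j mu hmu _|j _|j _|j _|j mu hmu _];
  rewrite !big_cons big_nil /= addr0.
- rewrite (@nth_Ncols_beta mu.-1 mu) 1?(@nth_Ncols_beta (mu + 1).-1 (mu + 1))
    1?(@nth_Ncols_alpha (3 * q - 6 + mu).-1 mu)
    1?(@nth_Ncols_alpha (3 * q - 5 + mu).-1 (mu + 1)); try lia.
  rewrite !coordE !big_cons !big_nil /=.
  np (q - (mu + 1))%N (q - (mu + 1 + 1)).+1; np (mu + 1 - 1)%N (mu - 1).+1.
  np (mu + 1 + 1)%N (mu + 1).+1.
  by rewrite !exprS; ring.
- rewrite (@nth_Ncols_beta 0 1) 1?(@nth_Ncols_alpha' (2 * q - 3).-1)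
    1?(@nth_Ncols_alpha (4 * q - 7).-1 (q - 1)) 1?(@nth_Ncols_gamma (4 * q - 6).-1)
    1?(@nth_Ncols_beta' (4 * q - 5).-1) 1?(@nth_Ncols_gamma' (4 * q - 4).-1); try lia.
  rewrite !coordE !big_cons !big_nil /=.
  np (q - 1 + 1)%N q; np (q - q)%N 0%N; np (q - 1 - 1)%N (q - 2)%N; np (q - (1 + 1))%N (q - 2)%N.
  have -> : x2 ^+ (q - 1) = x2 * x2 ^+ (q - 2) by rewrite -exprS; congr (_ ^+ _); lia.
  np (1 + 1)%N 2%N.
  by rewrite expr0; ring.
- rewrite (@nth_Ncols_beta (q - 1).-1 (q - 1)) 1?(@nth_Ncols_gamma'_ q.-1 1)
    1?(@nth_Ncols_alpha' (2 * q - 3).-1)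
    1?(@nth_Ncols_beta'_ (2 * q - 2).-1 2) 1?(@nth_Ncols_gamma (4 * q - 6).-1); try lia.
  rewrite !coordE !big_cons !big_nil /=.
  np (q - 1 + 1)%N q; np (q - q)%N 0%N; np (q + 1 + 2)%N (q + 3)%N; np (q + 2 + 1)%N (q + 3)%N.
  np (q + 1 + 3)%N (q + 4)%N; np (q + 2 + 2)%N (q + 4)%N; np (2 - 1)%N 1%N.
  have [-> ->] : x4 ^+ q = x4 * x4 ^+ (q - 1) /\ x2 ^+ (q - 1) = x2 * x2 ^+ (q - 2).
    by rewrite -!exprS; split; congr (_ ^+ _); lia.
  by rewrite expr0 !expr1; ring.
- rewrite (@nth_Ncols_gamma'_ (2 * q - 4).-1 (q - 3)) 1?(@nth_Ncols_beta'_ (3 * q - 6).-1 (q - 2))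
    1?(@nth_Ncols_alpha (3 * q - 5).-1 1)
    1?(@nth_Ncols_beta' (4 * q - 5).-1) 1?(@nth_Ncols_gamma' (4 * q - 4).-1); try lia.
  rewrite !coordE !big_cons !big_nil /=.
  np (q + (q - 3) + 2)%N (2 * q - 1)%N; np (q + (q - 3) + 3)%N (2 * q)%N.
  np (q + (q - 2) + 1)%N (2 * q - 1)%N; np (q + (q - 2) + 2)%N (2 * q)%N.
  np (q - (q - 3))%N 3%N; np (q - (q - 2))%N 2%N; np (1 - 1)%N 0%N; np (1 + 1)%N 2%N.
  np (q - 2 - 1)%N (q - 3)%N.
  have [-> ->] : x1 ^+ (q - 2) = x1 * x1 ^+ (q - 3) /\ x3 ^+ (q - 2) = x3 * x3 ^+ (q - 3).
    by rewrite -!exprS; split; congr (_ ^+ _); lia.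
  by rewrite expr0; ring.
- rewrite (@nth_Ncols_gamma'_ (q - 1 + mu).-1 mu) 1?(@nth_Ncols_gamma'_ (q + mu).-1 mu.+1)
    1?(@nth_Ncols_beta'_ (2 * q - 3 + mu).-1 mu.+1)
    1?(@nth_Ncols_beta'_ (2 * q - 2 + mu).-1 mu.+2); try lia.
  rewrite !coordE !big_cons !big_nil /=.
  np (q + mu.+1 + 1)%N (q + mu + 2)%N; np (q + mu.+1 + 2)%N (q + mu + 3)%N.
  np (q + mu.+1 + 3)%N (q + mu + 4)%N.
  np (q + mu.+2 + 1)%N (q + mu + 3)%N; np (q + mu.+2 + 2)%N (q + mu + 4)%N.
  np (mu.+1 - 1)%N mu; np (mu.+2 - 1)%N mu.+1; np (q - mu)%N (q - mu.+2).+2;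
  np (q - mu.+1)%N (q - mu.+2).+1.
  by rewrite !exprS; ring.
Qed.

End Columns.

(** * Explicit terms, leads and degrees of the columns *)

Section Terms.
Import GRing.Theory.
Local Open Scope ring_scope.
Variables (k : fieldType) (q : nat).
Local Notation R := {mpoly k[4]}.

Local Notation coord := (@Defs.coord k).
Local Notation x1 := (x1 k).
Local Notation x2 := (x2 k).
Local Notation x3 := (x3 k).
Local Notation x4 := (x4 k).

Definition mon (e : nat * nat * nat * nat) : 'X_{1..4} :=
  let: (a, b, c, d) := e in
  (U_(i1) *+ a + U_(i2) *+ b + U_(i3) *+ c + U_(i4) *+ d)%MM.

Lemma monE a b c d : [/\ mon (a, b, c, d) i1 = a, mon (a, b, c, d) i2 = b,
  mon (a, b, c, d) i3 = c & mon (a, b, c, d) i4 = d].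
Proof. by split; rewrite !mnmDE !mulmnE !mnm1E /=; lia. Qed.

Lemma ord4P (i : 'I_4) : [\/ i = i1, i = i2, i = i3 | i = i4].
Proof.
case: i => [[|[|[|[|i]]]] hi] //; [constructor 1|constructor 2|constructor 3|constructor 4];
  exact: val_inj.
Qed.

Lemma mnm4P (m m' : 'X_{1..4}) :
  m i1 = m' i1 -> m i2 = m' i2 -> m i3 = m' i3 -> m i4 = m' i4 -> m = m'.
Proof. by move=> e1 e2 e3 e4; apply/mnmP => i; case: (ord4P i) => ->. Qed.

Lemma lepm4 (m m' : 'X_{1..4}) : (m <= m')%MM =
  [&& m i1 <= m' i1, m i2 <= m' i2, m i3 <= m' i3 & m i4 <= m' i4]%N.
Proof.
apply/mnm_lepP/and4P => [le|[? ? ? ?] i]; first by split.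
by case: (ord4P i) => ->.
Qed.

Lemma mpolyX_mon a b c d :
  'X_[mon (a, b, c, d)] = x1 ^+ a * x2 ^+ b * x3 ^+ c * x4 ^+ d :> R.
Proof. by rewrite /mon !mpolyXD !mpolyXn. Qed.

Definition wt (w : 'I_4 -> nat) (e : nat * nat * nat * nat) : nat :=
  let: (a, b, c, d) := e in (a * w i1 + b * w i2 + c * w i3 + d * w i4)%N.

Lemma weight4 w (m : 'X_{1..4}) :
  weight w m = (m i1 * w i1 + m i2 * w i2 + m i3 * w i3 + m i4 * w i4)%N.
Proof.
rewrite /weight !big_ord_recr big_ord0 /= add0n.
by do 3?[congr (_ + _)%N]; congr (m _ * w _)%N; apply: val_inj.
Qed.

Lemma weight_mon w e : weight w (mon e) = wt w e.
Proof.
case: e => [[[a b] c] d]; have [h1 h2 h3 h4] := monE a b c d.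
by rewrite weight4 h1 h2 h3 h4.
Qed.

Lemma mon_inj : injective mon.
Proof.
move=> [[[a b] c] d] [[[a' b'] c'] d'] e.
have [e1 e2 e3 e4] := monE a b c d; have [] := monE a' b' c' d'.
by rewrite -e e1 e2 e3 e4 => -> -> -> ->.
Qed.

(* [(i, b, e)] stands for the coordinate [i] carrying [(-1)^b x^e]. *)
Definition term : Type := nat * bool * (nat * nat * nat * nat).

Definition tval (t : term) : R := (-1) ^+ t.1.2 *: 'X_[mon t.2].

Definition entry (T : seq term) (i : nat) : R :=
  \sum_(t <- T) tval t * (t.1.1 == i)%:R.

Definition trank (w : 'I_4 -> nat) (sh : nat -> nat) (t : term) : nat :=
  (sh t.1.1 + wt w t.2)%N.

Lemma entry_supp T i m : m \in msupp (entry T i) ->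
  exists2 t, t \in T & t.1.1 = i /\ mon t.2 = m.
Proof.
rewrite /entry; elim: T => [|t T IH]; first by rewrite big_nil msupp0.
rewrite big_cons => /msuppD_le; rewrite mem_cat => /orP [|/IH [t' t'T ?]]; last first.
  by exists t' => //; rewrite inE t'T orbT.
case: eqP => [ti|_]; last by rewrite mulr0 msupp0.
rewrite mulr1 => /msuppZ_le; rewrite msuppX inE => /eqP ->.
by exists t => //; rewrite inE eqxx.
Qed.

(** A term able to cancel the lead would share its coordinate and its monomial, hence its rank. *)
Lemma entry_lead w sh t T : all (fun t' => trank w sh t' < trank w sh t)%N T ->
  (entry (t :: T) t.1.1)@_(mon t.2) != 0.
Proof.
move=> /allP lt; rewrite /entry big_cons eqxx mulr1 mcoeffD mcoeffZ mcoeffX eqxx mulr1.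
rewrite -/(entry T _) (_ : (entry T _)@_ _ = 0) ?addr0 ?signr_eq0 //.
apply/eqP; rewrite mcoeff_eq0; apply/negP => /entry_supp [t' /lt + [e1 /mon_inj e2]].
by rewrite /trank e1 e2 ltnn.
Qed.

Lemma entry_rank w sh t T i m : all (fun t' => trank w sh t' < trank w sh t)%N T ->
  m \in msupp (entry (t :: T) i) -> (i, m) != (t.1.1, mon t.2) ->
  (sh i + weight w m < sh t.1.1 + weight w (mon t.2))%N.
Proof.
move=> /allP lt /entry_supp [t' + [<- <-]]; rewrite inE => /predU1P [->|/lt].
  by rewrite eqxx.
by rewrite !weight_mon.
Qed.

Hypothesis hq : (4 <= q)%N.

Local Notation NC := (Ncols k q).
Local Notation PC := (Pcols k q).

Definition wf (a b c d : nat) : 'I_4 -> nat := fun i => nth 0%N [:: a; b; c; d] i.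

(** The degree of the generator at coordinate [i], read off its monomial [Glead]; by [binom_deg] the
    other monomial has the same degree. *)
Definition gen_deg (i : nat) : nat :=
  if (i <= q)%N then wt (degs q) (i - 1, 0, q - i, 0)%N else
  if i == (q + 1)%N then wt (degs q) (0, q, 0, 0)%N else
  if i == (q + 2)%N then wt (degs q) (1, 1, 0, 0)%N else
  wt (degs q) (0, 2 * q + 2 - i, i - (q + 2), 0)%N.

(** The shifts decrease along the $f_\mu$, so that $x_1$ at $\mu$ beats $x_3$ at $\mu+1$ in
    [beta mu]. The coordinate of $g_2$ gets 0 because the weights of its entries grow with [q]. *)
Definition gen_shift (i : nat) : nat :=
  if (i <= q)%N then (4 * q - i)%N else if i == (q + 2)%N then 0%N else (4 * q + 1)%N.

(** The monomials with coefficients $1$ and $-1$, in this order, of the generator at position [j]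
    counted from 0; thus $h_m$ sits at $q+1+m$. *)
Definition binom (j : nat) : (nat * nat * nat * nat) * (nat * nat * nat * nat) :=
  if (j < q)%N then ((j, 0, q - j.+1, 0), (0, q - j.+1, 0, j + 2))%N else
  if j == q then ((q - 1, 0, 0, 0), (0, q, 0, 0))%N else
  if j == q.+1 then ((0, 0, 1, 1), (1, 1, 0, 0))%N else
  ((j - q.+1, 0, 0, 2 * q + 2 - j), (0, 2 * q + 1 - j, j - q.+1, 0))%N.

Definition Glead (j : nat) := if (j < q)%N then (binom j).1 else (binom j).2.
Definition Llead (j : nat) :=
  if (j < q)%N || (j == q.+1) then (binom j).1 else (binom j).2.

Definition lex_lt (e e' : nat * nat * nat * nat) : bool :=
  let: (a, b, c, d) := e in let: (a', b', c', d') := e' in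
  [|| c < c', (c == c') && (b < b'), [&& c == c', b == b' & a < a']
    | [&& c == c', b == b', a == a' & d < d']]%N.

(* The coordinate (counted from 1) and the exponent of the lead of the column of
   0-based position [j]. *)
Definition Nlead (j : nat) : nat * (nat * nat * nat * nat) :=
  if (j < q - 1)%N then (j.+1, (1, 0, 0, 0))%N else
  if (j < 2 * q - 4)%N then (j + 4, (0, 0, 1, 0))%N else
  if j == (2 * q - 4)%N then (q + 1, (1, 0, 0, 0))%N else
  if (j < 3 * q - 6)%N then (j + 6 - q, (1, 0, 0, 0))%N else
  if (j < 4 * q - 7)%N then (j + 8 - 3 * q, (0, 1, 0, 0))%N else
  if j == (4 * q - 7)%N then (q + 1, (0, 0, 1, 0))%N else
  if j == (4 * q - 6)%N then (2 * q, (0, 0, 1, 0))%N else (2 * q, (1, 0, 0, 0))%N.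

Definition rank_lt w sh : rel term := fun t t' => (trank w sh t < trank w sh t')%N.
Definition N_lt := rank_lt (wf 3 2 3 0) gen_shift.
Definition N_deg : term -> nat := trank (degs q) gen_deg.

(* These weights make the leads of the generators free of [x4]: modulo [x4] the
   ideal becomes monomial, and for the order [g2 < f_q2 < ... < f_1 < h_(q2-2) <
   ... < h_1 < g1] its successive colon ideals are generated by variables. These
   variables are the leads of [N]. *)
Definition G_lt := rank_lt (wf 2 2 3 0) (fun=> 0%N).
(** The weights $(3,3,6,1)$ single out the lexicographic leads of $S$ by a number, on which the
    reduction terminates; the second conjunct records the comparison needed for the Gröbner
    basis. *)
Definition L_lt : rel term := fun t t' => rank_lt (wf 3 3 6 1) (fun=> 0%N) t t' && lex_lt t.2 t'.2.

(* If [x1 e_c] is the lead of a column of [P], then the lead [y e] of the column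
   [c] of [N] has the same coordinate [e] as another lead [x1 e] of [N]. *)
Definition Plead (j : nat) : nat * (nat * nat * nat * nat) :=
  if (j < q - 2)%N then (3 * q - 5 + j, (1, 0, 0, 0))%N else
  if j == (q - 2)%N then (4 * q - 5, (1, 0, 0, 0))%N else
  if j == (q - 1)%N then (4 * q - 6, (1, 0, 0, 0))%N else
  if j == q then (2 * q - 4, (1, 0, 0, 0))%N else (j - 1, (1, 0, 0, 0))%N.

(** The shift 1 lifts the lead above the competing terms of weight 2, such as $x_2^2$ or a second
    $x_1$, in [xi], [zeta] and [eta]. *)
Definition rel_shift (i : nat) : nat :=
  if [|| q <= i <= 2 * q - 4, i == 4 * q - 6 | i == 4 * q - 5]%N then 1%N else 0%N.
Definition rel_deg (i : nat) : nat :=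
  (gen_deg (Nlead i.-1).1 + wt (degs q) (Nlead i.-1).2)%N.
Definition P_lt := rank_lt (wf 2 1 1 0) rel_shift.
Definition P_deg := trank (degs q) rel_deg.

Definition nonconst (t : term) : bool := (0 < wt (wf 1 1 1 1) t.2)%N.

Lemma tvalE i b a1 a2 a3 a4 : tval (i, b, (a1, a2, a3, a4)) =
  (-1) ^+ b * (x1 ^+ a1 * x2 ^+ a2 * x3 ^+ a3 * x4 ^+ a4).
Proof.
rewrite /tval mpolyX_mon -[(-1) ^+ b *: _]mul1r -scalerAr scalerAl; congr (_ * _).
by case: b => /=; rewrite ?expr0 ?expr1 ?scale1r ?scaleN1r.
Qed.

(** One description of a column serves three ends: the strict lead gives exactness, the common
    degree gives the grading, and the absence of constants gives minimality. *)
Definition column_ok (lt : rel term) (deg : term -> nat) (lead : nat * (nat * nat * nat * nat))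
    (c : svec k) : Prop :=
  exists t T, [/\ coord c =1 entry (t :: T), lead = (t.1.1, t.2),
    all (lt^~ t) T, all (fun t' => deg t' == deg t) T
    & all nonconst (t :: T)].

Ltac tv := rewrite ?tvalE ?expr0 ?expr1 ?mul1r ?mulr1 ?mulN1r //.
Ltac ent := move=> ?; rewrite coordE /entry !big_cons !big_nil /=; tv; try ring.
Ltac num := rewrite /= /nonconst /N_lt /rank_lt /N_deg /trank /gen_shift /gen_deg
  /wt /wf /degs /q1 /d1 /=; ifs; rewrite ?andbT; repeat (apply/andP; split); try lia.
(** Degree identities contain products of truncated differences. Each difference is replaced by its
    actual value, after which both sides agree as polynomials. *)
Ltac zring := zify; repeat match goal with
  | H : (_ /\ ?z = ?e) \/ _ |- _ => assert (z = e) by lia; clear H; subst z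
  end; lia.

Ltac col := split; [by ent | by rewrite /Nlead /=; ifs; congr (_, _); lia |
  by num | by num; zring | by num].

Lemma N_columns j : (j < 4 * (q - 1))%N ->
  column_ok N_lt N_deg (Nlead j) (nth [::] NC j).
Proof.
move: j; apply: (Ncols_ind hq (P := fun j c => column_ok N_lt N_deg (Nlead j) c)) =>
  [j mu hmu ->|j m hm ->|j ->|j m hm ->|j mu hmu ->|j ->|j ->|j ->].
- exists (mu, true, (1, 0, 0, 0))%N, [:: (mu + 1, false, (0, 0, 1, 0));
    (q + 2, false, (0, q - (mu + 1), 0, mu + 1))]%N; col.
- exists (q + m + 2, false, (0, 0, 1, 0))%N, [:: (q + 2, true, (m, 0, 0, q - m));
    (q + m + 3, true, (0, 1, 0, 0))]%N; col.
- exists (q + 1, false, (1, 0, 0, 0))%N, [:: (q, true, (1, 0, 0, 0));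
    (q + 2, true, (0, q - 1, 0, 0)); (q + 3, true, (0, 0, 0, 1))]%N; col.
- exists (q + m + 1, true, (1, 0, 0, 0))%N, [:: (q + 2, false, (0, q - m, m - 1, 0));
    (q + m + 2, false, (0, 0, 0, 1))]%N; col.
- exists (mu + 1, false, (0, 1, 0, 0))%N, [:: (mu, true, (0, 0, 0, 1));
    (q + 2, false, (mu - 1, 0, q - (mu + 1), 0))]%N; col.
- exists (q + 1, true, (0, 0, 1, 0))%N, [:: (q - 1, false, (1, 0, 0, 0));
    (q + 3, false, (0, 1, 0, 0))]%N; col.
- exists (2 * q, true, (0, 0, 1, 0))%N, [:: (1, true, (0, 2, 0, 0));
    (q + 1, false, (0, 1, 0, 2)); (q + 2, false, (q - 2, 0, 0, 2))]%N; col.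
- exists (2 * q, true, (1, 0, 0, 0))%N, [:: (2, true, (0, 2, 0, 0));
    (q + 1, false, (0, 0, 0, 3))]%N; col.
Qed.

Ltac pnum := rewrite /= ?andbT; repeat (apply/andP; split);
  rewrite /nonconst /P_lt /P_deg /rank_lt /trank /rel_shift /rel_deg /Nlead /=; ifs;
  rewrite /= /gen_deg /=; ifs; rewrite /wt /wf /degs /q1 /d1 /=; try lia.
Ltac pcol := split; [by ent | by rewrite /Plead /=; ifs; congr (_, _); lia |
  by pnum | by pnum; zring | by pnum].

Lemma P_columns j : (j < 2 * q - 3)%N ->
  column_ok P_lt P_deg (Plead j) (nth [::] PC j).
Proof.
move: j; apply: (Pcols_ind hq (P := fun j c => column_ok P_lt P_deg (Plead j) c)) =>
  [j mu hmu ->|j ->|j ->|j ->|j mu hmu ->].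
- exists (3 * q - 6 + mu, true, (1, 0, 0, 0))%N, [:: (mu, false, (0, 0, 0, 1));
    (mu + 1, true, (0, 1, 0, 0)); (3 * q - 5 + mu, false, (0, 0, 1, 0))]%N; pcol.
- exists (4 * q - 5, true, (1, 0, 0, 0))%N, [:: (1, false, (0, 2, 0, 0));
    (2 * q - 3, false, (0, 1, 0, 2)); (4 * q - 7, false, (1, 0, 0, 2));
    (4 * q - 6, false, (0, 0, 0, 3)); (4 * q - 4, false, (0, 0, 1, 0))]%N; pcol.
- exists (4 * q - 6, false, (1, 0, 0, 0))%N, [:: (q - 1, false, (1, 0, 0, 0));
    (q, false, (0, 0, 0, 1)); (2 * q - 3, false, (0, 0, 1, 0));
    (2 * q - 2, false, (0, 1, 0, 0))]%N; pcol.
- exists (2 * q - 4, true, (1, 0, 0, 0))%N, [:: (3 * q - 6, true, (0, 0, 1, 0));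
    (3 * q - 5, false, (0, 2, 0, 0)); (4 * q - 5, true, (0, 0, 0, 1));
    (4 * q - 4, false, (0, 1, 0, 0))]%N; pcol.
- exists (q - 1 + mu, true, (1, 0, 0, 0))%N, [:: (q + mu, false, (0, 0, 0, 1));
    (2 * q - 3 + mu, true, (0, 0, 1, 0)); (2 * q - 2 + mu, false, (0, 1, 0, 0))]%N; pcol.
Qed.

Lemma gens_binomial j : (j < 2 * q)%N ->
  nth 0 (gens k q) j = 'X_[mon (binom j).1] - 'X_[mon (binom j).2].
Proof.
move=> jq; rewrite /binom.
case: ltnP => h1.
  rewrite (@nth_gens_f _ _ hq j j.+1) // !mpolyX_mon /f_ !expr0 !mul1r !mulr1.
  by rewrite subn1 addn1 addn2.
case: eqP => [->|h2].
  by rewrite nth_gens_g1 // !mpolyX_mon /g1 /d1 !expr0 !mul1r !mulr1.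
case: eqP => [->|h3].
  by rewrite nth_gens_g2 // !mpolyX_mon /g2 !expr0 !expr1 !mul1r !mulr1 [x2 * x1]mulrC.
rewrite (@nth_gens_h _ _ hq j (j - q.+1)); try lia.
rewrite !mpolyX_mon /h_ /q1 !expr0 !mul1r !mulr1.
by congr (_ * _ ^+ _ - _ ^+ _ * _); lia.
Qed.

(** A generator as a column with a single coordinate, so that the row of generators is treated like
    [N] and [P]. *)
Definition gen_col (j : nat) : svec k := [:: (1%N, nth 0 (gens k q) j)].
Definition G_deg := trank (degs q) (fun=> 0%N).

Lemma binom_deg j : (j < 2 * q)%N -> wt (degs q) (binom j).1 = wt (degs q) (binom j).2.
Proof.
move=> jq; rewrite /binom; case: (ltnP j q) => h1; first by rewrite /wt /degs /q1 /d1 /=; zring.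
case: eqP => h2; first by rewrite /wt /degs /q1 /d1 /=; zring.
by case: eqP => h3; rewrite /wt /degs /q1 /d1 /=; zring.
Qed.

Lemma gen_columns (lt : rel term) (lead : nat -> nat * nat * nat * nat) j : (j < 2 * q)%N ->
  (lead j = (binom j).1 /\ lt (1%N, true, (binom j).2) (1%N, false, (binom j).1)) \/
  (lead j = (binom j).2 /\ lt (1%N, false, (binom j).1) (1%N, true, (binom j).2)) ->
  column_ok lt G_deg (1%N, lead j) (gen_col j).
Proof.
move=> jq H.
have deg_eq := binom_deg jq.
have nc : (0 < wt (wf 1 1 1 1) (binom j).1)%N && (0 < wt (wf 1 1 1 1) (binom j).2)%N.
  rewrite /binom; case: (ltnP j q) => h1; first by rewrite /wt /wf /=; lia.
  case: eqP => h2; first by rewrite /wt /wf /=; lia.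
  by case: eqP => h3; rewrite /wt /wf /=; lia.
have E i : coord (gen_col j) i = tval (1%N, false, (binom j).1) * (1%N == i)%:R
    + tval (1%N, true, (binom j).2) * (1%N == i)%:R.
  rewrite coordE big_cons big_nil /= gens_binomial // /tval /= expr0 expr1.
  by rewrite scale1r scaleN1r; ring.
case: H => -[-> h]; [exists (1%N, false, (binom j).1), [:: (1%N, true, (binom j).2)]
  | exists (1%N, true, (binom j).2), [:: (1%N, false, (binom j).1)]];
  (split=> //=; [|by rewrite h|by rewrite /G_deg /trank /= deg_eq eqxx
    |by rewrite /nonconst /=; case/andP: nc => -> ->]) => i;
  by rewrite E /entry !big_cons big_nil /=; ring.
Qed.

Lemma G_columns j : (j < 2 * q)%N -> column_ok G_lt G_deg (1%N, Glead j) (gen_col j).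
Proof.
move=> jq; apply: gen_columns => //; rewrite /Glead.
case: (ltnP j q) => h1; [left|right]; split=> //; rewrite /binom /G_lt /rank_lt /trank.
  by ifs; rewrite /= /wt /wf /=; lia.
rewrite ifF; last by lia.
case: eqP => h2; first by rewrite /= /wt /wf /=; lia.
by case: eqP => h3; rewrite /= /wt /wf /=; lia.
Qed.

Lemma L_columns j : (j < 2 * q)%N -> column_ok L_lt G_deg (1%N, Llead j) (gen_col j).
Proof.
move=> jq; apply: gen_columns => //; rewrite /Llead.
case: (ltnP j q) => h1 /=.
  by left; split=> //; rewrite /binom /L_lt /rank_lt /trank; ifs; rewrite /= /wt /wf /=; lia.
case: eqP => h3 /=; [left|right]; split=> //; rewrite /binom /L_lt /rank_lt /trank.
  by ifs; rewrite /= /wt /wf /=; lia.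
rewrite ifF; last by lia.
case: eqP => h2; first by rewrite /= /wt /wf /=; lia.
by rewrite ifF; last lia; rewrite /= /wt /wf /=; lia.
Qed.

End Terms.

(** * Combinatorics of the leads of the three matrices *)

Section ColumnFacts.
Import GRing.Theory.
Local Open Scope ring_scope.
Variables (k : fieldType) (q : nat).
Local Notation R := {mpoly k[4]}.
Local Notation coord := (@Defs.coord k).

Section Column.
Variables (lt : rel term) (w : 'I_4 -> nat) (sh : nat -> nat).
Variables (lead : nat * (nat * nat * nat * nat)) (c : svec k).
Hypothesis ok : column_ok lt (trank w sh) lead c.

Lemma column_deg i m : m \in msupp (coord c i) ->
  (sh i + weight w m = sh lead.1 + wt w lead.2)%N.
Proof.
have [t [T [-> -> _ dT _]]] := ok => /entry_supp [t' + [<- <-]].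
by rewrite inE weight_mon => /predU1P [->|/(allP dT) /eqP] //.
Qed.

Lemma column_const i : (coord c i)@_0 = 0.
Proof.
have [t [T [-> _ _ _ nc]]] := ok; apply/eqP; rewrite mcoeff_eq0; apply/negP.
case/entry_supp => t' /(allP nc) + [_ e]; rewrite /nonconst -weight_mon e.
by rewrite /weight big1 // => i' _; rewrite mnm0E.
Qed.

End Column.

Lemma columns_lead r s (M : 'M[R]_(r, s)) (cs : nat -> svec k) w sh deg lead
    (li : 'I_s -> 'I_r) :
  (forall i j, M i j = coord (cs j) i.+1) ->
  (forall j, (j < s)%N -> column_ok (rank_lt w sh) deg (lead j) (cs j)) ->
  (forall b, (li b).+1 = (lead b).1) ->
  lead_columns M w (fun a => sh a.+1) li (fun b => mon (lead b).2).
Proof.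
move=> ME ok liE b; have [t [T [E el lt _ _]]] := ok b (ltn_ord b).
rewrite liE el ME liE E el; split; first exact: entry_lead lt.
move=> a m; rewrite ME E => mT ne; apply: (entry_rank lt mT).
apply: contra ne => /eqP [e1 ->]; rewrite xpair_eqE eqxx andbT.
by rewrite -(inj_eq val_inj) /= -eqSS liE el e1.
Qed.

Lemma gens_rowE i j : gens_row k q i j = coord (gen_col k q j) i.+1.
Proof. by rewrite mxE coordE big_cons big_nil ord1 eqxx mulr1 addr0. Qed.

Lemma N_mxE i j : N_mx k q i j = coord (nth [::] (Ncols k q) j) i.+1.
Proof. by rewrite mxE. Qed.

Lemma P_mxE i j : P_mx k q i j = coord (nth [::] (Pcols k q) j) i.+1.
Proof. by rewrite mxE. Qed.

Hypothesis hq : (4 <= q)%N.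

Lemma gens_row_N : gens_row k q *m N_mx k q = 0.
Proof.
apply/matrixP => i j; rewrite !mxE.
under eq_bigr => l _ do rewrite N_mxE mxE.
rewrite (sum_coord (nth 0 (gens k q))) ?gens_Ncols //.
move: (nat_of_ord j) (ltn_ord j).
apply: (Ncols_ind hq (P := fun _ c => all (fun p => 0 < p.1 <= 2 * q)%N c));
  by move=> *; rewrite /= ?andbT; lia.
Qed.

Lemma N_P : N_mx k q *m P_mx k q = 0.
Proof.
apply/matrixP => i j; rewrite !mxE.
under eq_bigr => l _ do rewrite P_mxE N_mxE.
rewrite (sum_coord (fun l => coord (nth [::] (Ncols k q) l) i.+1)) ?Ncols_Pcols //.
move: (nat_of_ord j) (ltn_ord j).
apply: (Pcols_ind hq (P := fun _ c => all (fun p => 0 < p.1 <= 4 * (q - 1))%N c));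
  by move=> *; rewrite /= ?andbT; lia.
Qed.

Lemma Nlead_range j : (j < 4 * (q - 1))%N -> (0 < (Nlead q j).1 <= 2 * q)%N.
Proof. by move=> jq; rewrite /Nlead; do ?case: ifP => ? /=; lia. Qed.

Lemma Plead_range j : (j < 2 * q - 3)%N -> (0 < (Plead q j).1 <= 4 * (q - 1))%N.
Proof. by move=> jq; rewrite /Plead; do ?case: ifP => ? /=; lia. Qed.

Lemma mon_addP e (m : 'X_{1..4}) e' m' : (mon e + m = mon e' + m')%MM ->
  let: (a, b, c, d) := e in let: (a', b', c', d') := e' in
  [/\ a + m i1 = a' + m' i1, b + m i2 = b' + m' i2, c + m i3 = c' + m' i3
    & d + m i4 = d' + m' i4]%N.
Proof.
case: e e' => [[[a b] c] d] [[[a' b'] c'] d'] h.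
have [e1 e2 e3 e4] := monE a b c d; have [e1' e2' e3' e4'] := monE a' b' c' d'.
have H := (mnmP _ _).1 h.
by split; [have := H i1 | have := H i2 | have := H i3 | have := H i4];
  rewrite 2!mnmDE ?(e1, e2, e3, e4) ?(e1', e2', e3', e4').
Qed.

Lemma mon_le e (m : 'X_{1..4}) : (mon e <= m)%MM =
  let: (a, b, c, d) := e in [&& a <= m i1, b <= m i2, c <= m i3 & d <= m i4]%N.
Proof.
by case: e => [[[a b] c] d]; have [e1 e2 e3 e4] := monE a b c d; rewrite lepm4 e1 e2 e3 e4.
Qed.

Definition N_irr (a : nat) (m : 'X_{1..4}) := forall j, (j < 4 * (q - 1))%N ->
  (Nlead q j).1 = a.+1 -> ~~ (mon (Nlead q j).2 <= m)%MM.

(** All leads of [N] are variables, so irreducibility at a coordinate makes exponents vanish. With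
    [a] counted from 0, $g_1$ is at $q$ and the $h_m$ lie beyond $q+1$. *)
Lemma N_irrP (a : nat) m : (a < 2 * q)%N -> N_irr a m ->
  [/\ (a < q - 1)%N -> m i1 = 0%N, (0 < a < q)%N -> m i2 = 0%N &
      (a == q) || (q.+1 < a)%N -> m i1 = 0%N /\ m i3 = 0%N].
Proof.
move=> aq irr.
have use j e : (j < 4 * (q - 1))%N -> Nlead q j = (a.+1, e) -> ~~ (mon e <= m)%MM.
  by move=> jq h; have := irr j jq; rewrite h; apply.
split=> h.
- have := @use a (1, 0, 0, 0)%N; rewrite mon_le /Nlead; ifs.
  by move=> /(_ _ erefl); lia.
(* The position of [alpha a], whose lead $x_2$ is at coordinate $a+1$. *)
- have := @use (3 * q - 7 + a)%N (0, 1, 0, 0)%N; rewrite mon_le /Nlead; ifs.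
  move=> H; suff: ~~ [&& 0 <= m i1, 0 < m i2, 0 <= m i3 & 0 <= m i4]%N by lia.
  by apply: H; [lia | congr (_, _); lia].
have [j1 [j2 [l1 l2 e1 e2]]] : exists j1 j2, [/\ (j1 < 4 * (q - 1))%N, (j2 < 4 * (q - 1))%N,
    Nlead q j1 = (a.+1, (1, 0, 0, 0)%N) & Nlead q j2 = (a.+1, (0, 0, 1, 0)%N)].
  have [->|aq0] := eqVneq a q.
    exists (2 * q - 4)%N, (4 * q - 7)%N; rewrite /Nlead; ifs.
    by split; try lia; congr (_, _); lia.
  have [a2|a2] := eqVneq a (2 * q - 1)%N.
    exists (4 * q - 5)%N, (4 * q - 6)%N; rewrite /Nlead; ifs.
    by split; try lia; congr (_, _); lia.
  exists (q + a - 5)%N, (a - 3)%N; rewrite /Nlead; ifs.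
  by split; try lia; congr (_, _); lia.
have := use _ _ l1 e1; have := use _ _ l2 e2; rewrite !mon_le; lia.
Qed.

(** An irreducible [m] avoids the colon ideal of its lead by the preceding ones in the order $g_2,
    f_q, \ldots, f_1, h_{q-2}, \ldots, h_1, g_1$. Hence [j] is the first generator whose lead
    divides the product. *)
Lemma Glead_inj j j' m m' : (j < 2 * q)%N -> (j' < 2 * q)%N -> N_irr j m -> N_irr j' m' ->
  (mon (Glead q j) + m = mon (Glead q j') + m')%MM -> j = j'.
Proof.
move=> jq jq' /(N_irrP jq) [h1 h2 h3] /(N_irrP jq') [h1' h2' h3'] /mon_addP.
rewrite /Glead /binom; move: h1 h2 h3 h1' h2' h3'.
do ?case: ifP => ? //=; move=> h1 h2 h3 h1' h2' h3' [];  lia.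
Qed.

Definition P_irr (a : nat) (m : 'X_{1..4}) := forall j, (j < 2 * q - 3)%N ->
  (Plead q j).1 = a.+1 -> ~~ (mon (Plead q j).2 <= m)%MM.

(** The listed positions are those carrying a lead of [P], and each of these leads is $x_1$. *)
Lemma P_irrP (b : nat) m : P_irr b m ->
  [|| q - 1 <= b <= 2 * q - 5, 3 * q - 6 <= b <= 4 * q - 9, b == 4 * q - 7
    | b == 4 * q - 6]%N -> m i1 = 0%N.
Proof.
move=> irr hb; suff [j jq h] : exists2 j, (j < 2 * q - 3)%N & Plead q j = (b.+1, (1, 0, 0, 0)%N).
  by have := irr j jq; rewrite h mon_le /= => /(_ erefl); lia.
have [b1|b1] := leqP (3 * q - 6)%N b; last first.
  have [b2|b2] := eqVneq b (2 * q - 5)%N.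
    by exists q; rewrite /Plead; ifs; [lia | congr (_, _); lia].
  by exists (b + 2)%N; rewrite /Plead; ifs; [lia | congr (_, _); lia].
have [b2|b2] := eqVneq b (4 * q - 7)%N.
  by exists (q - 1)%N; rewrite /Plead; ifs; [lia | congr (_, _); lia].
have [b3|b3] := eqVneq b (4 * q - 6)%N.
  by exists (q - 2)%N; rewrite /Plead; ifs; [lia | congr (_, _); lia].
by exists (b - (3 * q - 6))%N; rewrite /Plead; ifs; [lia | congr (_, _); lia].
Qed.

(** Coordinate [q] is excepted because only [alpha (q - 1)] has its lead there, so it has no rival
    with lead $x_1$. *)
Lemma P_irr_x1 (b : nat) m : (b < 4 * (q - 1))%N -> P_irr b m ->
  (Nlead q b).2.1.1.1 = 0%N -> (Nlead q b).1 != q -> m i1 = 0%N.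
Proof.
move=> bq /P_irrP; rewrite /Nlead.
by do ?case: ifP => ? //=; lia.
Qed.

(** Each coordinate carries at most one lead $x_1$ and at most one other lead, so the coordinate and
    this alternative determine the column. *)
Lemma Nlead_view j : (j < 4 * (q - 1))%N ->
  let i := (Nlead q j).1 in
  ((Nlead q j).2 = (1, 0, 0, 0)%N /\ i != q /\
    j = (if i < q then i - 1 else if i == q + 1 then 2 * q - 4 else
         if i == 2 * q then 4 * q - 5 else q + i - 6)%N) \/
  ((Nlead q j).2 = (if i <= q then (0, 1, 0, 0) else (0, 0, 1, 0))%N /\
    j = (if i <= q then 3 * q - 8 + i else if i == q + 1 then 4 * q - 7 else
         if i == 2 * q then 4 * q - 6 else i - 4)%N).
Proof.
move=> jq; rewrite /Nlead.
case: ifP => h1; first by left=> /=; ifs; split; [|lia].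
case: ifP => h2; first by right=> /=; ifs; split; [|lia].
case: ifP => h3; first by left=> /=; ifs; split; [|lia].
case: ifP => h4; first by left=> /=; ifs; split; [|lia].
case: ifP => h5; first by right=> /=; ifs; split; [|lia].
case: ifP => h6; first by right=> /=; ifs; split; [|lia].
case: ifP => h7; first by right=> /=; ifs; split; [|lia].
by left=> /=; ifs; split; [|lia].
Qed.

(** Two different columns with leads at one coordinate have leads $x_1$ and $y \ne x_1$. Equal
    products would make $x_1$ divide the cofactor of $y$, against [P_irr_x1]. *)
Lemma Nlead_inj j j' m m' : (j < 4 * (q - 1))%N -> (j' < 4 * (q - 1))%N ->
  P_irr j m -> P_irr j' m' -> (Nlead q j).1 = (Nlead q j').1 ->
  (mon (Nlead q j).2 + m = mon (Nlead q j').2 + m')%MM -> j = j'.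
Proof.
move=> jq jq' irr irr' ei /mon_addP.
have := P_irr_x1 jq irr; have := P_irr_x1 jq' irr'.
have [[e [iq jE]]|[e jE]] := Nlead_view jq; have [[e' [iq' jE']]|[e' jE']] := Nlead_view jq';
  rewrite e e'.
- by rewrite jE jE' ei.
- by case: ifP => ? h _ []; rewrite (h erefl) ?add1n // -ei.
- by case: ifP => ? _ h []; rewrite (h erefl) ?add1n // ei.
- by rewrite jE jE' ei.
Qed.

Lemma Plead_inj j j' : (j < 2 * q - 3)%N -> (j' < 2 * q - 3)%N ->
  (Plead q j).1 = (Plead q j').1 -> j = j'.
Proof. by move=> jq jq'; rewrite /Plead; do ?case: ifP => ? //=; lia. Qed.

End ColumnFacts.

(** * The lexicographic order on exponents *)

Section Lex.
Import Order.TTheory.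

Definition lexm (m m' : 'X_{1..4}) : bool :=
  lex_lt (m i1, m i2, m i3, m i4) (m' i1, m' i2, m' i3, m' i4).

Lemma lex3214E (m m' : 'X_{1..4}) : lex3214 m m' = (m == m') || lexm m m'.
Proof.
rewrite /lex3214 /lex_le /lex_key /= !lexi_cons lexi0s.
rewrite !leEnat /lexm /=.
apply/idP/orP => [H|[/eqP ->|]]; last by lia.
  have [|h] := boolP (lexm m m'); [by right | left; apply/eqP; apply: mnm4P; move: h];
  by rewrite /lexm /=; lia.
by lia.
Qed.

Lemma lexm_mon e e' (m : 'X_{1..4}) : lex_lt e e' -> lexm (m + mon e) (m + mon e').
Proof.
case: e e' => [[[a b] c] d] [[[a' b'] c'] d'].
have [e1 e2 e3 e4] := monE a b c d; have [e1' e2' e3' e4'] := monE a' b' c' d'.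
rewrite /lexm !(mnmDE _ m) e1 e2 e3 e4 e1' e2' e3' e4' /=; lia.
Qed.

Lemma lexm_trans m2 m1 m3 : lexm m1 m2 -> lexm m2 m3 -> lexm m1 m3.
Proof. by rewrite /lexm /=; lia. Qed.

Lemma lexm_irr m : lexm m m = false.
Proof. by rewrite /lexm /=; lia. Qed.

End Lex.

(** * The toric ideal and standard monomials *)

Section Toric.
Import GRing.Theory.
Local Open Scope ring_scope.
Variables (k : fieldType) (q : nat).
Local Notation R := {mpoly k[4]}.
Local Notation toric := (toric_map (k := k) q).
Local Notation p := (@toric_ideal k q).

Lemma toric_X m : toric 'X_[m] = 'X^(weight (degs q) m).
Proof.
rewrite /toric_map mmapX /mmap1 /weight.
transitivity (\prod_(i < 4) ('X^(m i * degs q i) : {poly k})).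
  by apply: eq_bigr => i _; rewrite -exprM mulnC.
by elim/big_rec2: _ => // i x y _ ->; rewrite exprD.
Qed.

Lemma toric_is_ideal : is_ideal p.
Proof.
rewrite /toric_ideal /toric_map; split=> [|f g f0 g0|f g g0].
- exact: rmorph0.
- by rewrite rmorphD /= f0 g0 addr0.
- by rewrite rmorphM /= g0 mulr0.
Qed.

Lemma toric_coef (f : R) d :
  (toric f)`_d = \sum_(m <- msupp f) f@_m * (d == weight (degs q) m)%:R.
Proof.
rewrite {1}(mpolyE f) /toric_map rmorph_sum /= coef_sum; apply: eq_bigr => m _.
by rewrite mmapZ -/(toric 'X_[m]) toric_X coefCM coefXn.
Qed.

Hypothesis hq : (4 <= q)%N.
Hypothesis even_q : ~~ odd q.

Definition standard (m : 'X_{1..4}) : bool :=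
  [&& (m i3 == 0) || (m i4 == 0), m i1 + m i3 <= q - 2 & m i2 + m i3 <= q - 1]%N.

(* With [Q := 2 r + 2], reduce modulo [Q] to get [v = 0], then modulo the odd number
   [Q - 1], where [u * Q * (Q + 1)] becomes [2 u]. *)
Lemma weight_diophantine (r u v w : int) : 0 <= r ->
  - (2 * r + 1) <= v <= 2 * r + 1 -> - (2 * r) <= u <= 2 * r ->
  u * ((2 * r + 3) * (2 * r + 2)) + v * ((2 * r + 3) * (2 * r + 1))
    + w * ((2 * r + 2) * (2 * r + 1)) = 0 ->
  [/\ u = 0, v = 0 & w = 0].
Proof.
move=> r0 hv hu e.
have [t [vt tE]] : exists t, v = (2 * r + 2) * t /\
    t = u * (2 * r + 3) + v * (2 * r + 2) + w * (2 * r + 1).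
  by exists (u * (2 * r + 3) + v * (2 * r + 2) + w * (2 * r + 1)); split=> //; lia.
have t0 : t = 0 by nia.
have v0 : v = 0 by rewrite vt t0 mulr0.
have es : 2 * u = (2 * r + 1) * (- (u + w)) by move: tE; rewrite t0 v0; lia.
have [s sE] : exists s, u = (2 * r + 1) * s.
  by exists (u + r * (u + w)); lia.
have s0 : s = 0 by nia.
have u0 : u = 0 by rewrite sE s0 mulr0.
by split=> //; move: es; rewrite u0; nia.
Qed.

Lemma standard_weight_inj m m' : standard m -> standard m' ->
  weight (degs q) m = weight (degs q) m' -> m = m'.
Proof.
move=> /and3P [cd ac bc] /and3P [cd' ac' bc'].
rewrite !weight4 /degs /q1 /d1 /= => e.
move: (m i1) (m i2) (m i3) (m i4) (m' i1) (m' i2) (m' i3) (m' i4) cd ac bc cd' ac' bc' e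
  (@mnm4P m m') => a b c d a' b' c' d' cd ac bc cd' ac' bc' e eqm.
(* As $n_3 = n_1 + n_2 - n_4$, the degree is $(a+c)n_1 + (b+c)n_2 + (d-c)n_4$. Since $c$ or $d$ is
   zero, $d-c$ determines both. *)
suff : a + c = a' + c' /\ b + c = b' + c' /\ d + c' = d' + c by move=> ?; apply: eqm; lia.
have [r qE] : exists r, q = (2 * r + 2)%N by exists (q./2 - 1)%N; lia.
have [] := @weight_diophantine r%:Z ((a + c)%:Z - (a' + c')%:Z) ((b + c)%:Z - (b' + c')%:Z)
  ((d + c')%:Z - (d' + c)%:Z); lia.
Qed.

Lemma toric_standard0 (f : R) :
  (forall m, m \in msupp f -> standard m) -> p f -> f = 0.
Proof.
move=> fS pf; apply/eqP; rewrite -msupp_eq0 -size_eq0 eqn0Ngt; apply/negP.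
rewrite -has_predT => /hasP [m mf _].
have := toric_coef f (weight (degs q) m); rewrite pf coef0 (bigD1_seq m) //=.
rewrite eqxx mulr1 big_seq_cond big1 ?addr0 => [e|m' /andP[m'f ne]].
  by move: mf; rewrite mcoeff_msupp -e eqxx.
case: eqP => [e|]; last by rewrite mulr0.
by rewrite (standard_weight_inj (fS _ mf) (fS _ m'f) e) eqxx in ne.
Qed.

Lemma gens_toric f : f \in gens k q -> p f.
Proof.
move=> /(nthP 0) [j]; rewrite size_gens // => jq <-.
rewrite gens_binomial // /toric_ideal /toric_map rmorphB /=.
rewrite -/(toric 'X_[_]) -/(toric 'X_[mon (binom q j).2]) !toric_X !weight_mon.
by rewrite binom_deg ?subrr.
Qed.

Lemma L_irr_standard (m : 'X_{1..4}) :
  (forall j, (j < 2 * q)%N -> ~~ (mon (Llead q j) <= m)%MM) -> standard m.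
Proof.
move=> irr; have use j e : (j < 2 * q)%N -> Llead q j = e -> ~~ (mon e <= m)%MM.
  by move=> jq <-; apply: irr.
have cd : (m i3 == 0%N) || (m i4 == 0%N).
  have := @use q.+1 (0, 0, 1, 1)%N; rewrite mon_le /Llead /binom; ifs => /=.
  by move=> /(_ _ erefl); lia.
have ac : (m i1 + m i3 <= q - 2)%N.
  (* If $a + c \ge q-1$, then $x_1^j x_3^{q-1-j}$ with $j = \min(a, q-1)$ divides the monomial; it
     is the lead of $f_{j+1}$. *)
  have := @use (minn (m i1) (q - 1)) (minn (m i1) (q - 1), 0, q - (minn (m i1) (q - 1)).+1, 0)%N.
  by rewrite mon_le /Llead /binom; ifs => /=; move=> /(_ _ erefl); lia.
have bc : (m i2 + m i3 <= q - 1)%N.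
  have [c0|c0] := eqVneq (m i3) 0%N.
    have := @use q (0, q, 0, 0)%N; rewrite mon_le /Llead /binom; ifs => /=.
    by move=> /(_ _ erefl); lia.
  (* The position of $h_c$, whose lead is $x_2^{q-c}x_3^c$; [ac] gives $c \le q-2$. *)
  pose j := (q + 1 + m i3)%N; have jE : j = (q + 1 + m i3)%N by [].
  have := @use j (0, 2 * q + 1 - j, j - q.+1, 0)%N.
  by rewrite mon_le /Llead /binom; ifs => /=; move=> /(_ _ erefl); lia.
by apply/and3P.
Qed.

End Toric.

(** * Exactness, minimality and the Gröbner basis *)

Section Main.
Import GRing.Theory.
Local Open Scope ring_scope.
Variables (k : fieldType) (q : nat).
Local Notation R := {mpoly k[4]}.
Local Notation p := (@toric_ideal k q).
Local Notation S := (gens k q).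
Local Notation G := (gens_row k q).
Local Notation N := (N_mx k q).
Local Notation P := (P_mx k q).
Hypothesis hq : (4 <= q)%N.
Hypothesis even_q : ~~ odd q.

Lemma column_ok_sub (lt lt' : rel term) deg lead (c : svec k) : subrel lt lt' ->
  column_ok lt deg lead c -> column_ok lt' deg lead c.
Proof.
move=> sub [t [T [E el lT dT nc]]]; exists t, T; split=> //.
by apply: sub_all lT => t' /sub.
Qed.

Lemma L_lead : lead_columns G (wf 3 3 6 1) (fun=> 0%N) (fun=> 0)
  (fun b => mon (Llead q b)).
Proof.
apply: (columns_lead (cs := gen_col k q) (deg := G_deg q) (lead := fun j => (1%N, Llead q j))
  (sh := fun=> 0%N)) => //; first exact: gens_rowE.
by move=> j /(L_columns k hq); apply: column_ok_sub => t t' /andP [].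
Qed.

Lemma G_lead : lead_columns G (wf 2 2 3 0) (fun=> 0%N) (fun=> 0)
  (fun b => mon (Glead q b)).
Proof.
apply: (columns_lead (cs := gen_col k q) (deg := G_deg q) (lead := fun j => (1%N, Glead q j))
  (sh := fun=> 0%N)) => //; first exact: gens_rowE.
exact: G_columns.
Qed.

Lemma N_lead : exists2 li : 'I_(4 * (q - 1)) -> 'I_(2 * q),
  forall b, (li b).+1 = (Nlead q b).1
  & lead_columns N (wf 3 2 3 0) (fun a => gen_shift q a.+1) li (fun b => mon (Nlead q b).2).
Proof.
have /fin_all_exists [li liE] (b : 'I_(4 * (q - 1))) :
    exists a : 'I_(2 * q), a.+1 = (Nlead q b).1.
  have := Nlead_range hq (ltn_ord b); case: (Nlead q b).1 => // a ha.
  by exists (Ordinal ha).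
exists li => //.
apply: (columns_lead (cs := fun j => nth [::] (Ncols k q) j) (deg := N_deg q)) => //.
  exact: N_mxE.
exact: N_columns.
Qed.

Lemma P_lead : exists2 li : 'I_(2 * q - 3) -> 'I_(4 * (q - 1)),
  forall b, (li b).+1 = (Plead q b).1
  & lead_columns P (wf 2 1 1 0) (fun a => rel_shift q a.+1) li (fun b => mon (Plead q b).2).
Proof.
have /fin_all_exists [li liE] (b : 'I_(2 * q - 3)) :
    exists a : 'I_(4 * (q - 1)), a.+1 = (Plead q b).1.
  have := Plead_range hq (ltn_ord b); case: (Plead q b).1 => // a ha.
  by exists (Ordinal ha).
exists li => //.
apply: (columns_lead (cs := fun j => nth [::] (Pcols k q) j) (deg := P_deg q)) => //.
  exact: P_mxE.
exact: P_columns.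
Qed.

Lemma gens_lex_supp i (j : 'I_(2 * q)) m : m \in msupp (G i j) ->
  exists e, m = mon e /\ ((e == Llead q j) || lex_lt e (Llead q j)).
Proof.
have [t [T [E el lT _ _]]] := L_columns k hq (ltn_ord j).
rewrite gens_rowE E => /entry_supp [t' tT [_ <-]]; exists t'.2; split=> //.
case: el => _ ->; move: tT; rewrite inE => /predU1P [->|/(allP lT) /andP [_ ->]].
  by rewrite eqxx.
by rewrite orbT.
Qed.

(** The numerical rank ensures termination, while [Q] confines the remainder to a lexicographically
    down-closed set of monomials. *)
Lemma lex_reduce (f : R) (Q : 'X_{1..4} -> Prop) :
  (forall m m', Q m -> lexm m' m -> Q m') -> (forall m, m \in msupp f -> Q m) ->
  exists u : 'cV_(2 * q), forall m, m \in msupp (f - (G *m u) 0 0) -> standard q m /\ Q m.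
Proof.
move=> Qlex fQ.
have := reduce L_lead (Q := fun _ => Q) _ (v := const_mx f).
case=> [b m a m' Qm /gens_lex_supp [e [-> /predU1P [->//|h]]]|a m|u hu].
- by apply: (Qlex _ _ Qm); exact: lexm_mon.
- by rewrite mxE; apply: fQ.
exists u => m mf; have [] := hu 0 m; first by rewrite mxE [const_mx f 0 0]mxE mxE.
move=> irr Qm; split=> //; apply: L_irr_standard => // j jq.
exact: (irr (Ordinal jq)).
Qed.

Lemma G_toric (u : 'cV_(2 * q)) : p ((G *m u) 0 0).
Proof.
have idp := toric_is_ideal k q; rewrite mxE; apply: (ideal_sum _ idp) => j _.
case: idp => _ _ pM; rewrite mulrC; apply: pM; apply: gens_toric => //.
by rewrite mxE mem_nth // size_gens.
Qed.

(** The remainder of an element of the ideal is again in the ideal and is supported on standard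
    monomials, so it is zero. *)
Lemma toricP f : p f <-> exists u : 'cV_(2 * q), f = (G *m u) 0 0.
Proof.
split=> [pf|[u ->]]; last exact: G_toric.
have [//|//|u hu] := @lex_reduce f (fun=> True).
exists u; apply/eqP; rewrite -subr_eq0; apply/eqP; apply: (toric_standard0 hq even_q).
  by move=> m /hu [].
case: (toric_is_ideal k q) => _ pD pM; apply: pD => //; rewrite -mulN1r; apply: pM.
exact: G_toric.
Qed.

Lemma gens_generate : generates S p.
Proof.
have [[_ _ iM] iA] := ideal_genP (of_seq S).
move=> f; split=> [|/toricP [u ->]].
  by apply: ideal_gen_min => [|g]; [exact: toric_is_ideal | exact: gens_toric].
rewrite mxE; apply: ideal_sum => [|j _]; first by have [] := ideal_genP (of_seq S).
by rewrite mulrC; apply: iM; apply: iA; rewrite /of_seq mxE mem_nth // size_gens.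
Qed.

Lemma kernel_G (v : 'cV_(2 * q)) : G *m v = 0 <-> exists w, v = N *m w.
Proof.
split=> [Gv|[w ->]]; last by rewrite mulmxA gens_row_N // mul0mx.
have [li liE lead] := N_lead.
have [//|//|u hu] := reduce lead (Q := fun _ _ => True) _ (v := v).
exists u; apply/eqP; rewrite -subr_eq0; apply/eqP.
apply: (leads_inj G_lead (Y := fun b m => N_irr q b m)).
- move=> b b' m m' irr irr' _ e; apply: val_inj.
  exact: (Glead_inj hq (ltn_ord b) (ltn_ord b') irr irr' e).
- move=> a m /hu [irr _] j jq ej; apply: (irr (Ordinal jq)).
  by apply: val_inj; apply: succn_inj; rewrite liE.
by rewrite mulmxBr Gv mulmxA gens_row_N // mul0mx subrr.
Qed.

Lemma kernel_N (v : 'cV_(4 * (q - 1))) : N *m v = 0 <-> exists w, v = P *m w.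
Proof.
split=> [Nv|[w ->]]; last by rewrite mulmxA N_P // mul0mx.
have [liN liNE leadN] := N_lead; have [li liE lead] := P_lead.
have [//|//|u hu] := reduce lead (Q := fun _ _ => True) _ (v := v).
exists u; apply/eqP; rewrite -subr_eq0; apply/eqP.
apply: (leads_inj leadN (Y := fun b m => P_irr q b m)).
- move=> b b' m m' irr irr' eli e; apply: val_inj.
  apply: (Nlead_inj hq (ltn_ord b) (ltn_ord b') irr irr' _ e).
  by rewrite -!liNE eli.
- move=> a m /hu [irr _] j jq ej; apply: (irr (Ordinal jq)).
  by apply: val_inj; apply: succn_inj; rewrite liE.
by rewrite mulmxBr Nv mulmxA N_P // mul0mx subrr.
Qed.

(** The leads of [P] lie at pairwise distinct coordinates, so they cannot coincide for any
    vector. *)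
Lemma kernel_P (v : 'cV_(2 * q - 3)) : P *m v = 0 -> v = 0.
Proof.
have [li liE lead] := P_lead.
apply: (leads_inj lead (Y := fun _ _ => True)) => // b b' m m' _ _ eli _; apply: val_inj.
by apply: (Plead_inj hq (ltn_ord b) (ltn_ord b')); rewrite -!liE eli.
Qed.

Lemma resolution : free_resolution p (res_complex k q).
Proof.
have augE (v : 'cV_1) : (const_mx 1 *m v) 0 0 = v 0 0 :> R.
  by rewrite mxE big_ord1 mxE mul1r.
split=> [f|v|[|[|[|i]]] v] /=.
- exists (const_mx f); rewrite augE mxE subrr; case: (toric_is_ideal k q) => p0 _ _.
  exact: p0.
- rewrite augE toricP; split=> [[u e]|[u ->]]; exists u => //.
  by apply/colP => i; rewrite ord1.
- exact: kernel_G.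
- exact: kernel_N.
- split=> [/kernel_P ->|[w ->]]; last by rewrite mulmxA mulmx0 mul0mx.
  by exists 0; rewrite mulmx0.
- have v0 : v = 0 by apply/colP; case.
  by split=> _; [exists 0; rewrite mulmx0 | rewrite v0 mulmx0].
Qed.

Lemma dif_const i a b : (dif (res_complex k q) i a b)@_0 = 0.
Proof.
case: i a b => [|[|[|i]]] a b /=; last by rewrite mxE mcoeff0.
- by rewrite gens_rowE; apply: column_const (G_columns k hq (ltn_ord b)) _.
- by rewrite N_mxE; apply: column_const (N_columns k hq (ltn_ord b)) _.
- by rewrite P_mxE; apply: column_const (P_columns k hq (ltn_ord b)) _.
Qed.

Lemma resolution_minimal : minimal (res_complex k q).
Proof. by move=> i a b; apply: max_idealP; apply: dif_const. Qed.

Lemma gen_deg_lead j : (j < 2 * q)%N -> gen_deg q j.+1 = wt (degs q) (Glead q j).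
Proof.
move=> jq; rewrite /gen_deg /Glead /binom.
have [h1|h1] := ltnP j q; first by rewrite /= subn1.
have [->|h2] := eqVneq j q; first by ifs.
have [->|h3] := eqVneq j q.+1; first by ifs.
by ifs; congr (wt _ (_, _, _, _)); lia.
Qed.

Lemma resolution_graded : graded (degs q) (res_complex k q).
Proof.
(* Columns are homogeneous, so a basis vector gets the degree of the lead of its column. *)
exists (fun i a => match i with 0 => 0 | 1 => gen_deg q a.+1 | 2 => rel_deg q a.+1
  | 3 => rel_deg q (Plead q a).1 + wt (degs q) (Plead q a).2 | _ => 0 end)%N; split.
  by move=> a m; rewrite mxE msupp1 inE => /eqP ->; rewrite /weight big1 // => i; rewrite mnm0E.
case=> [|[|[|i]]] a b m /=; last by case: b.
- rewrite gens_rowE => mS; rewrite gen_deg_lead //.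
  by have /= := column_deg (G_columns k hq (ltn_ord b)) mS; rewrite !add0n.
- by rewrite N_mxE => mS; have := column_deg (N_columns k hq (ltn_ord b)) mS.
- by rewrite P_mxE => mS; have := column_deg (P_columns k hq (ltn_ord b)) mS.
Qed.

(** Syzygies are combinations of the columns of [N], whose entries have no constant term. A relation
    with a unit coefficient is thus impossible, which rules out repeated and redundant
    generators. *)
Lemma unit_syzygy (v : 'cV_(2 * q)) : G *m v = 0 -> forall i, (v i 0)@_0 = 0.
Proof.
move=> /kernel_G [w ->] i; rewrite mxE raddf_sum /= big1 // => j _.
by rewrite rmorphM /= (dif_const (i := 1%N)) mul0r.
Qed.

Lemma G_delta (i : 'I_(2 * q)) : G *m delta_mx i 0 = const_mx S`_i :> 'cV_1.
Proof. by rewrite -colE; apply/colP => j; rewrite !mxE. Qed.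

Lemma uniq_gens : uniq S.
Proof.
apply/(uniqP 0) => i j; rewrite !inE !size_gens // => iq jq e; apply/eqP/negPn/negP => ne.
have /unit_syzygy - /(_ (Ordinal iq)) :
    G *m (delta_mx (Ordinal iq) 0 - delta_mx (Ordinal jq) 0 : 'cV_(2 * q)) = 0.
  by rewrite mulmxBr !G_delta /= e subrr.
have neo : (Ordinal iq == Ordinal jq) = false by rewrite -(inj_eq val_inj); apply: negPf.
by rewrite !mxE neo !eqxx subr0 => /eqP; rewrite mcoeff1 eqxx oner_eq0.
Qed.

(** If [s] were missing from [T], writing it through [T] would give a syzygy with constant
    coefficient 1 at the coordinate of [s]. *)
Lemma gens_minimal : minimal_generating_set S p.
Proof.
split; first exact: gens_generate.
move=> T TS /(_ _) genT s sS; apply/negPn/negP => sT.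
have [m [a [b [bT sE]]]] : ideal_gen (of_seq T) s by apply/genT; apply: gens_toric.
have ltS f : f \in S -> (index f S < 2 * q)%N by rewrite -index_mem size_gens.
pose idx i := Ordinal (ltS _ (TS _ (bT i))).
have /unit_syzygy - /(_ (Ordinal (ltS _ sS))) :
    G *m (delta_mx (Ordinal (ltS _ sS)) 0 - \sum_i a i *: delta_mx (idx i) 0 : 'cV_(2 * q)) = 0.
  rewrite mulmxBr G_delta mulmx_sumr /= nth_index //; apply/eqP; rewrite subr_eq0; apply/eqP.
  apply/colP => j; rewrite mxE summxE sE; apply: eq_bigr => i _.
  by rewrite -scalemxAr G_delta !mxE /= nth_index //; exact: TS (bT i).
rewrite !mxE summxE !eqxx mcoeffB mcoeff1 eqxx => /eqP; rewrite subr_eq0 => /eqP e.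
move: (oner_neq0 k); rewrite -[1]/(true%:R : k) e raddf_sum /= big1 ?eqxx // => i _.
rewrite !mxE andbT -(inj_eq val_inj) /=; case: eqP => [ei|]; last by rewrite mulr0 mcoeff0.
case/negP: sT; rewrite -(nth_index 0 sS) ei nth_index; last exact: TS (bT i).
exact: bT.
Qed.

(** Let [m] be the leading monomial of [f] in the ideal. If no lead of $S$ divides [m], then [m] is
    standard; reducing the tail of [f] yields an element of the ideal that has standard support and
    still contains [m], contradicting [toric_standard0]. *)
Lemma gens_groebner : groebner_basis lex3214 S p.
Proof.
split; first exact: gens_toric.
have [idS iA] := ideal_genP (lead_terms lex3214 (of_seq S)).
have [idp ip] := ideal_genP (lead_terms lex3214 p).
move=> t; split; apply: ideal_gen_min => // {}t [f [m [fS lm ->]]].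
  by apply: ip; exists f, m; split=> //; apply: gens_toric.
have [mf mmax] := lm.
have [/existsP [j jm]|irr] := boolP [exists j : 'I_(2 * q), (mon (Llead q j) <= m)%MM].
  have [lc0 _] := L_lead j; set c := (G 0 j)@_(mon (Llead q j)) in lc0.
  have -> : f@_m *: 'X_[m] =
      ((f@_m / c) *: 'X_[m - mon (Llead q j)]) * (c *: 'X_[mon (Llead q j)]).
    by rewrite -scalerAl -scalerAr scalerA divfK // -mpolyXD submK.
  case: (idS) => _ _ iM; apply: iM; apply: iA; exists (G 0 j), (mon (Llead q j)); split=> //.
    by rewrite /of_seq mxE mem_nth // size_gens.
  split=> [|m']; first by rewrite mcoeff_msupp.
  case/gens_lex_supp => e [-> /orP [/eqP ->|h]]; rewrite lex3214E ?eqxx //.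
  by have := lexm_mon 0%MM h; rewrite !add0m => ->; rewrite orbT.
have stm : standard q m.
  apply: L_irr_standard => // j jq; apply/negP => jm; case/existsP: irr.
  by exists (Ordinal jq).
pose f' := f - f@_m *: 'X_[m].
have f'lt m' : m' \in msupp f' -> lexm m' m.
  have [->|ne] := eqVneq m' m.
    by rewrite mcoeff_msupp /f' mcoeffB mcoeffZ mcoeffX eqxx mulr1 subrr eqxx.
  rewrite mcoeff_msupp /f' mcoeffB mcoeffZ mcoeffX [m == m']eq_sym (negPf ne) mulr0 subr0.
  by rewrite -mcoeff_msupp => /mmax; rewrite lex3214E (negPf ne).
(* Choosing [Q] as the monomials below [m] prevents the remainder from cancelling the term at
   [m]. *)
have [|//|u hu] := @lex_reduce f' (fun m' => lexm m' m).
  by move=> m1 m2 h1 h2; apply: lexm_trans h2 h1.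
have : f@_m *: 'X_[m] + (f' - (G *m u) 0 0) = 0.
  apply: (toric_standard0 hq even_q) => [m'|].
    move=> /msuppD_le; rewrite mem_cat => /orP [/msuppZ_le|/hu [] //].
    by rewrite msuppX inE => /eqP ->.
  rewrite addrA /f' addrCA subrr addr0.
  case: (toric_is_ideal k q) => _ pD pM; apply: pD => //; rewrite -mulN1r; apply: pM.
  exact: G_toric.
move/(congr1 (fun g : R => g@_m)); rewrite mcoeffD mcoeff0 mcoeffZ mcoeffX eqxx mulr1.
rewrite [X in _ + X](_ : _ = 0) ?addr0 => [fm0|].
  by move: mf; rewrite mcoeff_msupp fm0 eqxx.
by apply/eqP; rewrite mcoeff_eq0; apply/negP => /hu []; rewrite lexm_irr.
Qed.

End Main.

Theorem theorem1p1 (k : fieldType) (q2 : nat) (hq2 : 4 <= q2)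
    (even_q2 : ~~ odd q2) :
  let p := @toric_ideal k q2 in
  let S := gens k q2 in
  minimal_generating_set S p /\
  groebner_basis lex3214 S p /\
  (betti p 1 (size (undup S)) /\ size (undup S) = 2 * q2) /\
  betti p 2 (4 * (q2 - 1)) /\
  betti p 3 (2 * q2 - 3) /\
  minimal_free_resolution (degs q2) p (res_complex k q2).
Proof.
move=> p S; have betti_res i : betti p i.+1 (res_rank q2 i.+1).
  apply: (betti_minimal (toric_is_ideal k q2) i (resolution _ hq2 even_q2)).
  exact: resolution_minimal.
have szS : size (undup S) = 2 * q2.
  by rewrite undup_id ?size_gens //; apply: uniq_gens.
split; first exact: gens_minimal.
split; first exact: gens_groebner.
split; first by rewrite szS; split=> //; apply: (betti_res 0).
split; first exact: (betti_res 1).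
split; first exact: (betti_res 2).
by split; [exact: resolution | exact: resolution_minimal | exact: resolution_graded].
Qed.
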